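(* Let $\mathcal G=(V_0,V_1,E,\Omega)$ be an explicitly given Müller game with $V=V_0\cup V_1$, and run on it the algorithm described in the context. Let $Win_0$ denote the final value of the algorithm's set variable of that name. Then the set $Win_0(\mathcal G)$ of vertices from which player 0 wins $\mathcal G$ and the set $Win_1(\mathcal G)$ of vertices from which player 1 wins $\mathcal G$ satisfy $$Win_0(\mathcal G)=Win_0\cap V\quad\text{and}\quad Win_1(\mathcal G)=V\setminus Win_0 .$$
   Context: Müller game $\mathcal G=(V_0,V_1,E,\Omega)$: $V_0,V_1$ disjoint finite sets, $V=V_0\cup V_1$, $E\subseteq (V_0\times V_1)\cup(V_1\times V_0)$, $\Omega\subseteq 2^V$; its arena is $G=(V_0,V_1,E)$. It is explicitly given if $V$, $E$ and all sets of $\Omega$ are listed in the input. $E(X)$ is the set of successors of vertices in $X$. When the token is at $v\in V_\sigma$, player $\sigma$ moves it to a vertex of $E(v)$; if $E(v)=\emptyset$ is reached, player 1 wins; an infinite play is won by player 0 iff the set of vertices visited infinitely often belongs to $\Omega$. These games are determined. A set $S\subseteq V$ determines a subgame if $E(v)\cap S\neq\emptyset$ for all $v\in S$; $\mathcal G(S)$ is then the game restricted to $S$ (edges inside $S$, winning sets $\Omega\cap 2^S$). $S$ is a $\sigma$-trap if it determines a subgame and $E(S\cap V_\sigma)\subseteq S$. $\mathcal G(S)$ is called forced-connected if $S$ determines a subgame and player 0 wins from every vertex of $S$ the game on the arena restricted to $S$ with the single winning set $S$. $Attr_\sigma(X,G)$ is the set of vertices of the arena $G$ from which player $\sigma$ can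 force the token into $X$. Horn's construction: for a game $\mathcal G$ and $W\in\Omega$ with $\mathcal G(W)$ forced-connected and $W$ not a 1-trap, $\mathcal G_W$ has the vertices of $\mathcal G$ plus one new player-1 vertex $\mathbf W$, edges $E\cup\big((V_0\cap W)\times\{\mathbf W\}\big)\cup\big(\{\mathbf W\}\times(E(V_1\cap W)\setminus W)\big)$, and winning family $\Omega_W=(\Omega\cup\{W'\cup\{\mathbf W\}:W'\in R\})\setminus(R\cup\{W\})$, where $R=\{W'\in\Omega: W\subsetneq W'\}$. Algorithm. List $\Omega$ as $W_1<\dots<W_r$ so that $X\subsetneq Y$ implies $X<Y$. Initialise the current game $\mathcal G'=(G',\Omega')$ to $\mathcal G$ and $Win_0:=\emptyset$. While $\Omega'\neq\emptyset$: take the first set $W'$ of $\Omega'$ in the list order. (i) If $W'$ does not determine a subgame of $\mathcal G'$, or $\mathcal G'(W')$ is not forced-connected, delete $W'$ from $\Omega'$. (ii) If $\mathcal G'(W')$ is forced-connected and $W'$ is a 1-trap in $\mathcal G'$, add $Attr_0(W',G')$ to $Win_0$, and delete these vertices from the arena $G'$, together with all sets of $\Omega'$ that meet $Attr_0(W',G')$ (and $W'$ itself). (iii) Otherwise replace $\mathcal G'$ by $\mathcal G'_{W'}$; the modified sets $X\cup\{\mathbf W'\}$ keep the place of $X$ in the list. *)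

(* Defs.v *)
From HB Require Import structures.
From mathcomp Require Import all_boot.
From mathcomp Require Import boolp.

Set Implicit Arguments.
Unset Strict Implicit.
Unset Printing Implicit Defensive.

Section Games.
Variable T : finType.

Record arena := Arena {
  vert0 : {set T};
  vert1 : {set T};
  edges : {set T * T} }.

Record game := Game {
  arena_of :> arena;
  Omega : {set {set T}} }.

Implicit Types (G : arena) (S X : {set T}) (p : nat -> T) (sigma : bool).

Definition verts G := vert0 G :|: vert1 G.

(* Players are booleans: [false] is player 0 and [true] is player 1. *)
Definition vert_of G sigma := if sigma then vert1 G else vert0 G.

Definition succs G X := [set y | [exists x in X, (x, y) \in edges G]].

Definition succ G x := succs G [set x].

Definition muller_game (H : game) : Prop :=
  [/\ [disjoint vert0 H & vert1 H],
      edges H \subset setX (vert0 H) (vert1 H) :|: setX (vert1 H) (vert0 H) &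
      Omega H \subset powerset (verts H)].

(* Maximal plays are total sequences: a finite play that ends in a vertex
   without successors is represented by repeating this vertex forever. As edges
   alternate between the players, no other play has two equal consecutive vertices. *)
Definition play G p : Prop :=
  forall n, if succ G (p n) == set0 then p n.+1 = p n
            else p n.+1 \in succ G (p n).

(* A strategy maps a history, whose last item is the current vertex, to the next
   vertex. *)
Definition strategy := seq T -> T.

Definition legal G sigma (f : strategy) : Prop :=
  forall h x, x \in vert_of G sigma -> succ G x != set0 ->
    f (rcons h x) \in succ G x.

Definition consistent G sigma (f : strategy) p : Prop :=
  forall n, p n \in vert_of G sigma -> succ G (p n) != set0 ->
    p n.+1 = f (mkseq p n.+1).

Definition can_force G sigma x (P : (nat -> T) -> Prop) : Prop :=
  exists2 f : strategy, legal G sigma f &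
    forall p, p 0 = x -> play G p -> consistent G sigma f p -> P p.

Definition inf_set p : {set T} :=
  [set x | `[< forall m, exists2 n, m <= n & p n = x >]].

Definition won0 (H : game) p : Prop :=
  (forall n, succ H (p n) != set0) /\ inf_set p \in Omega H.

Definition won_by (H : game) sigma p : Prop :=
  if sigma then ~ won0 H p else won0 H p.

Definition wins (H : game) sigma x : Prop := can_force H sigma x (won_by H sigma).

Definition Win (H : game) sigma : {set T} :=
  [set x in verts H | `[< wins H sigma x >]].

Definition Attr sigma X G : {set T} :=
  [set x in verts G | `[< can_force G sigma x (fun p => exists n, p n \in X) >]].

Definition restrict G S :=
  Arena (vert0 G :&: S) (vert1 G :&: S) (edges G :&: setX S S).

Definition determines_subgame G S : bool :=
  (S \subset verts G) && [forall x in S, succ G x :&: S != set0].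

Definition trap sigma G S : bool :=
  determines_subgame G S && (succs G (S :&: vert_of G sigma) \subset S).

Definition forced_connected G S : bool :=
  determines_subgame G S &&
  (S \subset Win (Game (restrict G S) [set S]) false).

Definition strict_supersets (H : game) (W : {set T}) :=
  [set X in Omega H | W \proper X].

(* [w] is the name of the new vertex; it has to be fresh for [H]. *)
Definition horn (H : game) (W : {set T}) (w : T) : game :=
  let R := strict_supersets H W in
  Game
    (Arena (vert0 H) (w |: vert1 H)
       (edges H :|: setX (vert0 H :&: W) [set w]
                :|: setX [set w] (succs H (vert1 H :&: W) :\: W)))
    ((Omega H :|: [set w |: X | X in R]) :\: (W |: R)).

Definition inclusion_listing (O : {set {set T}}) (s : seq {set T}) : Prop :=
  [/\ uniq s, s =i O &
      forall X Y, X \in s -> Y \in s -> X \proper Y -> index X s < index Y s].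

End Games.

Section Algorithm.
Variable T : finType.

(* Vertices of the games met by the algorithm: those of the input game, tagged
   with [inl], and the added ones, tagged with [inr]. *)
Definition vertex : finType := (T + {set T})%type.

Definition embed_set (X : {set T}) : {set vertex} := inl @: X.

Definition embed (H : game T) : game vertex :=
  Game
    (Arena (embed_set (vert0 H)) (embed_set (vert1 H))
       [set (inl e.1, inl e.2) | e in edges H])
    [set embed_set X | X in Omega H].

(* The sets treated by the algorithm are listed sets enlarged by added vertices
   only, so their input vertices identify their place in the list and the name
   below is used at most once. *)
Definition new_vertex (W : {set vertex}) : vertex := inr (inl @^-1: W).

(* [order] keeps the sets that have been deleted from [Omega]. *)
Record state := State {
  cur : game vertex;
  order : seq {set vertex};
  win0 : {set vertex} }.

Definition init (H : game T) (s : seq {set T}) : state :=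
  State (embed H) (map embed_set s) set0.

Definition treat (st : state) (W : {set vertex}) : state :=
  let G := cur st in
  if ~~ forced_connected G W then
    State (Game G (Omega G :\ W)) (order st) (win0 st)
  else if trap true G W then
    let A := Attr false W G in
    State
      (Game (restrict G (~: A)) ([set X in Omega G | [disjoint X & A]] :\ W))
      (order st) (win0 st :|: A)
  else
    let w := new_vertex W in
    State (horn G W w)
      [seq if X \in strict_supersets G W then w |: X else X | X <- order st]
      (win0 st).

Definition step (st : state) : state :=
  if [seq X <- order st | X \in Omega (cur st)] is W :: _ then treat st W
  else st.

(* The loop is unrolled [#|Omega H|] times, which is enough by [run_exit]; [step]
   is the identity once [Omega] is empty. *)
Definition run (H : game T) (s : seq {set T}) : state :=
  iter #|Omega H| step (init H s).

Definition algorithm_Win0 (H : game T) (s : seq {set T}) : {set vertex} :=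
  win0 (run H s).

Lemma step_order st :
  {subset Omega (cur st) <= order st} ->
  {subset Omega (cur (step st)) <= order (step st)} /\
  #|Omega (cur (step st))| <= #|Omega (cur st)|.-1.
Proof.
move=> sub; rewrite /step.
case E: [seq X <- order st | X \in Omega (cur st)] => [|W l].
  split=> //; suff -> : Omega (cur st) = set0 by rewrite cards0.
  apply/setP=> X; rewrite inE; apply/negP => XO.
  have : X \in [seq X <- order st | X \in Omega (cur st)].
    by rewrite mem_filter XO sub.
  by rewrite E.
have: W \in [seq X <- order st | X \in Omega (cur st)] by rewrite E mem_head.
rewrite mem_filter => /andP[WO _]; rewrite /treat.
have cardW : #|Omega (cur st) :\ W| = #|Omega (cur st)|.-1.
  by rewrite (cardsD1 W (Omega (cur st))) WO.
case: ifP => _ /=; first by split=> [X /setD1P[_ /sub]|]; rewrite ?cardW.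
case: ifP => _ /=.
  split=> [X|]; first by rewrite !inE => /and3P[_ /sub].
  by rewrite -cardW; apply/subset_leq_card/setSD/subsetP=> X; rewrite inE => /andP[].
set R := strict_supersets _ _; set w := new_vertex W.
split=> [X|].
  rewrite !inE negb_or => /andP[/andP[_ XR]] /orP[XO|/imsetP[Y YR ->]].
    by apply/mapP; exists X; rewrite ?sub // /R inE (negbTE XR).
  apply/mapP; exists Y; last by rewrite YR.
  by apply: sub; move: YR; rewrite inE => /andP[].
have RO : R \subset Omega (cur st) :\ W.
  apply/subsetP=> X; rewrite !inE => /andP[-> WX]; rewrite andbT.
  by apply: contraTneq WX => ->; rewrite properxx.
rewrite -cardW -(cardsID R (Omega (cur st) :\ W)) (setIidPr RO) addnC.
rewrite setDUl; apply: (leq_trans (leq_card_setU _ _)); apply: leq_add.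
  by rewrite setDDl.
exact: leq_trans (subset_leq_card (subsetDl _ _)) (leq_imset_card _ _).
Qed.

Lemma run_exit (H : game T) (s : seq {set T}) :
  inclusion_listing (Omega H) s -> Omega (cur (run H s)) = set0.
Proof.
case=> _ sO _; apply/eqP; rewrite -cards_eq0 -leqn0 /run.
have init_sub : {subset Omega (cur (init H s)) <= order (init H s)}.
  by move=> _ /imsetP[X XO ->]; rewrite map_f // sO.
suff [_] : {subset Omega (cur (iter #|Omega H| step (init H s)))
              <= order (iter #|Omega H| step (init H s))} /\
    #|Omega (cur (iter #|Omega H| step (init H s)))| <= #|Omega H| - #|Omega H|.
  by rewrite subnn.
elim: {1 2 3 5}#|Omega H| => [|n [IHs IHn]].
  by rewrite subn0; split=> //; apply: leq_imset_card.
rewrite iterS; have [Ss Sn] := step_order IHs; split=> //.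
by rewrite subnS; apply: leq_trans Sn _; rewrite -!subn1 leq_sub2r.
Qed.

End Algorithm.

(* Main.v *)
Require Import Defs.
From HB Require Import structures.
From mathcomp Require Import all_boot.
From mathcomp Require Import boolp.

Set Implicit Arguments.
Unset Strict Implicit.
Unset Printing Implicit Defensive.

(* Winning regions are certified by Zielonka decompositions [winsr]: finite
   derivations that are sound for strategies and exist for one of the players on
   each part of a suitable splitting of every arena without dead ends, which
   also gives determinacy. Every region won by a player contains a region
   which this player wins, which the opponent cannot leave, and whose vertex set
   is itself good for this player. Horn's construction then preserves the winner
   by induction on regions: a counterexample yields such a region [D] in the new
   game, and whether or not [D] contains the new vertex [w], either [D :\ w] or
   a smaller region contradicts the assumption on the old game. A minimal set [W]
   that is not forced-connected can be deleted since no decomposition for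
   player 0 has [W] as one of its regions. *)

(** * Regions and their decompositions *)

(** Decompositions replace strategies because Horn's construction changes the histories: a strategy
    would have to be rebuilt around the visits to [w], while a finite derivation is handled by
    induction on the size of its region. Almost every contradiction is the single fact
    [winsr_disjoint]: a region won by a player has no nonempty part that this player cannot leave
    and that the opponent wins. As it only refutes, the Horn step is proved for both players, and
    [split_exists] turns the failure of one player into a region of the other. On the side of the
    algorithm, the winning sets grow together with the game. What stays fixed is their trace on the
    input vertices. It gives the place in the list, hence the minimality of the treated set, and
    also the name of the added vertex, hence its freshness. Dead ends become loops beforehand, so
    attractors and traps need no special case, and arenas of different sizes share one vertex
    type. *)

Record tgame (T : finType) := TGame {
  edge : rel T;
  owner : pred T;
  winning : pred {set T} }.

Lemma negb_neq (a b : bool) : a != b -> a = ~~ b.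
Proof. by case: a b => -[]. Qed.

Section Regions.
Variables (T : finType) (g : tgame T).
Implicit Types (S D A X Y P : {set T}) (x y : T) (sigma : bool).

Local Notation e := (edge g).
Local Notation o := (owner g).

(** Players are booleans, so the exclusive or negates the winning condition exactly for player 1. *)
Definition good sigma X := winning g X (+) sigma.

Definition live S := forall x, x \in S -> exists2 y, y \in S & e x y.

(** [sigma] is the player who cannot leave [D]. Only moves inside [S] count, which makes traps
    compose. *)
Definition gtrap sigma D S :=
  [/\ D \subset S,
      forall x y, x \in D -> o x = sigma -> y \in S -> e x y -> y \in D &
      forall x, x \in D -> o x = ~~ sigma -> exists2 y, y \in D & e x y].

Definition attr_step sigma S X Y :=
  [set x in S | (x \in X) ||
     (if o x == sigma then [exists y in Y, e x y]
      else [forall y in S, e x y ==> (y \in Y)])].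

Definition attr sigma S X := fixset (attr_step sigma S X).

Lemma attr_step_mono sigma S X :
  {homo attr_step sigma S X : Y Z / Y \subset Z}.
Proof.
move=> Y Z /subsetP YZ; apply/subsetP=> x; rewrite !inE => /andP[-> /=].
case: (x \in X) => //=; case: ifP => _.
  by move=> /'exists_andP[y [/YZ yZ exy]]; apply/'exists_andP; exists y.
move=> /forall_inP all_y; apply/forall_inP=> y /all_y /implyP yY.
by apply/implyP=> /yY /YZ.
Qed.

Lemma attrE sigma S X x :
  (x \in attr sigma S X) = (x \in S) && ((x \in X) ||
     (if o x == sigma then [exists y in attr sigma S X, e x y]
      else [forall y in S, e x y ==> (y \in attr sigma S X)])).
Proof.
by rewrite /attr -[in LHS](fixsetK (@attr_step_mono sigma S X)) inE.
Qed.

Lemma attr_sub sigma S X : attr sigma S X \subset S.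
Proof. by apply/subsetP=> x; rewrite attrE => /andP[]. Qed.

Lemma sub_attr sigma S X : X \subset S -> X \subset attr sigma S X.
Proof.
by move=> /subsetP XS; apply/subsetP=> x xX; rewrite attrE xX XS.
Qed.

Lemma card_attrC sigma S X x : x \in S -> x \in X ->
  #|S :\: attr sigma S X| < #|S|.
Proof.
move=> xS xX; apply/proper_card/properP; split; first exact: subsetDl.
by exists x => //; rewrite inE attrE xS xX.
Qed.

(** The chosen successor lowers the rank [fix_order]. The property is stated for every stage [n],
    the form used by an induction along a play; where nothing has to be attracted, the move is just
    some edge inside [S]. *)
Lemma attr_move sigma S X : live S ->
  exists att : T -> T,
    (forall x, x \in S -> att x \in S /\ e x (att x)) /\
    (forall x n, x \in iter n.+1 (attr_step sigma S X) set0 ->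
       x \notin X -> o x = sigma ->
       att x \in iter n (attr_step sigma S X) set0).
Proof.
move=> liveS; set F := attr_step sigma S X.
have monoF : {homo F : Y Z / Y \subset Z} := @attr_step_mono sigma S X.
suff /choice[att attP] : forall x, exists y, (x \in S -> y \in S /\ e x y) /\
    forall n, x \in iter n.+1 F set0 -> x \notin X -> o x = sigma ->
      y \in iter n F set0.
  by exists att; split=> x; case: (attP x).
have sub n : iter n F set0 \subset S.
  by case: n => [|n]; [rewrite sub0set | apply/subsetP=> x; rewrite inE => /andP[]].
move=> x; case: (boolP [&& x \in attr sigma S X, x \notin X & o x == sigma]).
  case/and3P=> xA xX /eqP ox.
  have := in_iter_fix_orderE F x; rewrite xA.
  have := fix_order_gt0 F x; rewrite xA.
  case Er: (fix_order F x) => [|r] // _; rewrite /= inE (negbTE xX) ox eqxx /=.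
  move=> /andP[_ /'exists_andP[y [yr exy]]]; exists y; split.
    by move=> _; split=> //; apply: (subsetP (sub r)).
  move=> n xn _ _; have := @fix_order_small _ _ monoF x n.+1 xn.
  by rewrite Er ltnS => /(subset_iter monoF)/subsetP; apply.
move=> nA; case: (boolP (x \in S)) => xS.
  have [y yS exy] := liveS x xS; exists y; split=> // n xn xX ox.
  by case/negP: nA; rewrite xX ox eqxx (subsetP (iter_sub_fix monoF n.+1)).
by exists x; split=> // n; rewrite /= inE (negbTE xS).
Qed.

Lemma gtrap_refl sigma S : live S -> gtrap sigma S S.
Proof. by move=> liveS; split=> // x /liveS. Qed.

Lemma gtrap_trans sigma D P S : gtrap sigma D P -> gtrap sigma P S ->
  gtrap sigma D S.
Proof.
move=> [DP D1 D2] [PS P1 P2]; split=> //; first exact: subset_trans PS.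
move=> x y xD ox yS exy; apply: (D1 x) => //.
exact: P1 (subsetP DP _ xD) ox yS exy.
Qed.

Lemma gtrap_sub sigma D P S : gtrap sigma D S -> D \subset P -> P \subset S ->
  gtrap sigma D P.
Proof.
move=> [_ D1 D2] DP PS; split=> // x y xD ox yP; apply: D1 xD ox _.
exact: (subsetP PS).
Qed.

Lemma live_gtrap sigma D S : live S -> gtrap sigma D S -> live D.
Proof.
move=> liveS [DS D1 D2] x xD; have [ox|/negb_neq] := eqVneq (o x) sigma.
  have [y yS exy] := liveS x (subsetP DS _ xD).
  by exists y => //; apply: D1 xD ox yS exy.
exact: D2.
Qed.

Lemma gtrap_attrC sigma S X : live S -> gtrap sigma (S :\: attr sigma S X) S.
Proof.
move=> liveS; split; first exact: subsetDl.
  move=> x y /setDP[xS xA] ox yS exy; rewrite inE yS andbT.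
  apply: contra xA => yA; rewrite attrE xS ox eqxx; apply/orP; right.
  by apply/'exists_andP; exists y.
move=> x /setDP[xS]; rewrite attrE xS negb_or => /andP[_] + ox.
rewrite ox; case: sigma {ox} => /=; rewrite negb_forall => /existsP[y];
  by rewrite !negb_imply => /and3P[yS exy yA]; exists y; rewrite // inE yS yA.
Qed.

(* Zielonka's decomposition: in [WinsTop] the winner either visits every vertex
   of [S] infinitely often or finally stays outside of some attractor. *)
Inductive winsr sigma : {set T} -> Prop :=
| WinsEmpty : winsr sigma set0
| WinsDominion S D A : live S -> gtrap (~~ sigma) D S -> D \subset A ->
    A \subset attr sigma S D -> winsr sigma D -> winsr sigma (S :\: A) ->
    winsr sigma S
| WinsTop S : live S -> good sigma S ->
    (forall a, a \in S -> winsr sigma (S :\: attr sigma S [set a])) ->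
    winsr sigma S.

Lemma winsr_live sigma S : winsr sigma S -> live S.
Proof. by case=> // x; rewrite inE. Qed.

Lemma attr0 sigma S : live S -> attr sigma S set0 = set0.
Proof.
move=> liveS; rewrite /attr /fixset; elim: #|T| => //= n ->.
apply/setP=> x; rewrite !inE /=; apply/negbTE/negP=> /andP[xS].
case: ifP => _.
  by case/'exists_andP=> y []; rewrite inE.
have [y yS exy] := liveS x xS.
by move=> /forall_inP/(_ y yS); rewrite exy inE.
Qed.

(** An empty [D] has an empty attractor, so [S :\: A] is [S] and the witness comes from the last
    premise of the rule; a nonempty [D] passes on its own witness, and [WinsTop] yields [S]. *)
Lemma winsr_dominion sigma S : winsr sigma S -> S != set0 ->
  exists D, [/\ D != set0, gtrap (~~ sigma) D S, winsr sigma D & good sigma D].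
Proof.
elim=> {S} [|S D A liveS trD DA Aattr winD IHD winSA IHSA|S liveS goodS win IH].
- by rewrite eqxx.
- move=> S0; have [D0|D0] := eqVneq D set0.
    have A0 : A = set0 by apply/eqP; rewrite -subset0 -(attr0 sigma liveS) -D0.
    by rewrite A0 setD0 in IHSA; apply: IHSA.
  have [P [P0 trP winP goodP]] := IHD D0.
  by exists P; split=> //; apply: gtrap_trans trP trD.
- move=> S0; exists S; split=> //; first exact: gtrap_refl.
  exact: WinsTop.
Qed.

(** Attractors are computed in a large region, but the dominion rule is applied in a smaller one,
    where the attractor may grow. This is why [WinsDominion] only bounds [A] from above by an
    attractor. *)
Lemma attr_restrict sigma S P X : attr sigma S X \subset P -> P \subset S ->
  attr sigma S X \subset attr sigma P X.
Proof.
move=> attrP /subsetP PS.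
have monoF : {homo attr_step sigma S X : Y Z / Y \subset Z}.
  exact: attr_step_mono.
suff sub n : iter n (attr_step sigma S X) set0 \subset attr sigma P X by apply: sub.
elim: n => [|n /subsetP IHn]; first by rewrite sub0set.
apply/subsetP=> x xn; have xP : x \in P.
  by apply: (subsetP attrP); apply: (subsetP (iter_sub_fix monoF n.+1)).
move: xn; rewrite /= inE attrE xP => /andP[_ /orP[-> //|]].
case: ifP => _ h; apply/orP; right.
  case/'exists_andP: h => y [/IHn yA exy].
  by apply/'exists_andP; exists y.
apply/forall_inP=> y yP; apply/implyP=> exy; apply: IHn.
by move/forall_inP: h => /(_ y (PS _ yP)); rewrite exy.
Qed.

Definition splits sigma S P :=
  [/\ gtrap (~~ sigma) P S, winsr sigma P, gtrap sigma (S :\: P) S &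
      winsr (~~ sigma) (S :\: P)].

Lemma splitsC sigma S P : splits sigma S P -> splits (~~ sigma) S (S :\: P).
Proof.
case=> [trP wP trC wC]; have PS : P \subset S by case: trP.
by split; rewrite ?negbK // setDDr setDv set0U (setIidPr PS).
Qed.

(** Zielonka's induction on size. The player [rho] for whom [S] itself is good wins all of [S] by
    [WinsTop], or the opponent wins a nonempty [D] outside some attractor. Removing the opponent's
    attractor of [D] leaves a smaller region, and everything except the part that [rho] wins there
    falls to the opponent. *)
Lemma split_exists S sigma : live S -> exists P, splits sigma S P.
Proof.
have [n] := ubnP #|S|; elim: n S sigma => // n IHn S sigma leSn liveS.
suff [rho [P trP]] : exists rho P, splits rho S P.
  have [->|/negb_neq->] := eqVneq sigma rho; first by exists P.
  by exists (S :\: P); apply: splitsC.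
exists (~~ winning g S); set rho := ~~ _.
have goodS : good rho S by rewrite /good /rho; case: (winning g S).
case: (pselect (forall a, a \in S -> winsr rho (S :\: attr rho S [set a]))).
  move=> all_a; exists S; rewrite /splits setDv; split; first exact: gtrap_refl.
  - exact: WinsTop.
  - by split=> [|x y|x]; rewrite ?sub0set ?inE.
  - exact: WinsEmpty.
move=> /existsNP[a /not_implyP[aS nwin]].
set S1 := S :\: attr rho S [set a] in nwin.
have trS1 : gtrap rho S1 S by apply: gtrap_attrC.
have ltS1 : #|S1| < n.
  rewrite -ltnS; apply: leq_trans leSn; rewrite ltnS.
  exact: card_attrC aS (set11 a).
have liveS1 := live_gtrap liveS trS1.
have [P1 [trP1 wP1 trD wD]] := IHn S1 rho ltS1 liveS1.
set D := S1 :\: P1 in trD wD.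
have D0 : D != set0.
  apply: contra_notN nwin => /eqP D0.
  suff -> : S1 = P1 by [].
  by apply/eqP; rewrite eqEsubset -setD_eq0 -/D D0 eqxx; case: trP1.
have {}trD : gtrap rho D S := gtrap_trans trD trS1.
have [DS _ _] := trD.
set A := attr (~~ rho) S D; set S2 := S :\: A.
have DA : D \subset A by apply: sub_attr.
have trS2 : gtrap (~~ rho) S2 S by apply: gtrap_attrC.
have liveS2 := live_gtrap liveS trS2.
have ltS2 : #|S2| < n.
  case/set0Pn: D0 => d dD; rewrite -ltnS; apply: leq_trans leSn; rewrite ltnS.
  exact: card_attrC (subsetP DS _ dD) dD.
have [P2 [trP2 wP2 trC wC]] := IHn S2 rho ltS2 liveS2.
have P2S : P2 \subset S2 by case: trP2.
(* Player [rho] has no edge from [A] to [P2]: [D] is a trap for [rho], and the attracted vertices of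
   [rho] have all their successors in [A]. *)
have trC' : gtrap rho (S :\: P2) S.
  split; first exact: subsetDl.
    move=> x y /setDP[xS xP2] ox yS exy; rewrite inE yS andbT.
    apply/negP=> yP2; have /setDP[_ yA] := subsetP P2S _ yP2.
    case: (boolP (x \in A)) => xA; last first.
      have xC : x \in S2 :\: P2 by rewrite !inE xP2 xA xS.
      case: trC => _ /(_ x y xC ox (subsetP P2S _ yP2) exy) + _.
      by rewrite inE yP2.
    move: (xA); rewrite /A attrE xS /= => /orP[xD|].
      case/negP: yA; apply: (subsetP DA).
      by case: trD => _ /(_ x y xD ox yS exy).
    have -> : (o x == ~~ rho) = false by rewrite ox; case: (rho).
    by move=> /forall_inP/(_ y yS); rewrite exy (negbTE yA).
  move=> x /setDP[xS xP2] ox.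
  have inC y : y \in A -> y \in S :\: P2.
    move=> yA; rewrite inE (subsetP (attr_sub (~~ rho) S D)) // andbT.
    by apply: contraL yA => /(subsetP P2S)/setDP[].
  case: (boolP (x \in A)) => xA; last first.
    have xC : x \in S2 :\: P2 by rewrite !inE xP2 xA xS.
    case: trC => _ _ /(_ x xC ox)[y /setDP[/setDP[yS _] yP2] exy].
    by exists y => //; rewrite inE yP2.
  move: (xA); rewrite /A attrE xS /= => /orP[xD|].
    case: trD => _ _ /(_ x xD ox)[y yD exy]; exists y => //.
    exact/inC/(subsetP DA).
  by rewrite ox eqxx => /'exists_andP[y [/inC yC exy]]; exists y.
exists P2; split=> //; first exact: gtrap_trans trP2 trS2.
have AC : A \subset S :\: P2.
  apply/subsetP=> y yA; rewrite inE (subsetP (attr_sub (~~ rho) S D)) // andbT.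
  by apply: contraL yA => /(subsetP P2S)/setDP[].
apply: (@WinsDominion _ _ D A) => //.
- exact: live_gtrap trC'.
- by rewrite negbK; apply: gtrap_sub trD _ (subsetDl _ _); apply: subset_trans AC.
- by apply: attr_restrict => //; apply: subsetDl.
- by rewrite setDDl setUC -setDDl.
Qed.

End Regions.

(** * Soundness for strategies *)

Section Plays.
Variable T : finType.
Implicit Types (p : nat -> T) (f : strategy T).

Definition shift p k : nat -> T := fun n => p (k + n).

Lemma inf_set_shift p k : inf_set (shift p k) = inf_set p.
Proof.
apply/setP=> x; rewrite !inE; apply/asboolP/asboolP=> inf m.
  have [n mn <-] := inf m; exists (k + n) => //.
  exact: leq_trans mn (leq_addl _ _).
have [n mn pn] := inf (k + m); exists (n - k).
  by rewrite -(leq_add2l k) subnKC // (leq_trans _ mn) ?leq_addr.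
by rewrite /shift subnKC // (leq_trans _ mn) ?leq_addr.
Qed.

Lemma history_play (x : T) (next : seq T -> T -> T) :
  exists2 p, p 0 = x & forall n, p n.+1 = next (mkseq p n.+1) (p n).
Proof.
pose H n := iter n (fun h => rcons h (next h (last x h))) [:: x].
pose p n := last x (H n).
have HE n : mkseq p n.+1 = H n.
  elim: n => [|n IHn]; first by rewrite /mkseq.
  by rewrite mkseqS IHn /p /= last_rcons.
by exists p => // n; rewrite HE /p /= last_rcons.
Qed.

(** The failure just before [j] reveals the memory with which the stable phase begins; [winss_top]
    relies on it. *)
Lemma stable_from (P : nat -> Prop) N : (forall n, N <= n -> P n) ->
  exists j, (forall n, j <= n -> P n) /\ (j = 0 \/ ~ P j.-1).
Proof.
elim: N => [|N IHN] PN; first by exists 0; split; [|left].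
case: (pselect (P N)) => [PN'|nPN]; last by exists N.+1; split=> //; right.
by apply: IHN => n; rewrite leq_eqVlt => /orP[/eqP<-|/PN].
Qed.

End Plays.

Section Soundness.
Variables (T : finType) (g : tgame T).
Implicit Types (S D A X Y P : {set T}) (x y : T) (sigma : bool).
Implicit Types (p : nat -> T) (f : strategy T).

Local Notation e := (edge g).
Local Notation o := (owner g).

Definition play_in S p := forall n, p n \in S /\ e (p n) (p n.+1).

Definition follows sigma f p :=
  forall n, o (p n) = sigma -> p n.+1 = f (mkseq p n.+1).

Definition strategy_in sigma S f := forall h x, x \in S -> o x = sigma ->
  f (rcons h x) \in S /\ e x (f (rcons h x)).

Definition winning_in sigma S f :=
  forall p, play_in S p -> follows sigma f p -> good g sigma (inf_set p).

Definition winss sigma S :=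
  exists2 f, strategy_in sigma S f & winning_in sigma S f.

(** A strategy is run as a machine: [ms n] is the memory after reading [p 0] up to [p n]. Legality
    is asked at every updated memory, reachable or not. *)
Lemma winss_machine (x0 : T) sigma S (M : Type) (m0 : M) (upd : M -> T -> M)
    (out : M -> T -> T) :
  (forall m x, x \in S -> o x = sigma ->
     out (upd m x) x \in S /\ e x (out (upd m x) x)) ->
  (forall p (ms : nat -> M), play_in S p -> ms 0 = upd m0 (p 0) ->
     (forall n, ms n.+1 = upd (ms n) (p n.+1)) ->
     (forall n, o (p n) = sigma -> p n.+1 = out (ms n) (p n)) ->
     good g sigma (inf_set p)) ->
  winss sigma S.
Proof.
move=> legal win; exists (fun h => out (foldl upd m0 h) (last x0 h)).
  by move=> h x xS ox; rewrite foldl_rcons last_rcons; apply: legal.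
move=> p pS fp; pose ms n := foldl upd m0 (mkseq p n.+1).
apply: (win p ms) => // n => [|on]; rewrite /ms.
- by rewrite mkseqS foldl_rcons.
- by rewrite fp // [in last _ _]mkseqS last_rcons.
Qed.

Lemma attr_reach sigma S X att p N :
  (forall x n, x \in iter n.+1 (attr_step g sigma S X) set0 ->
     x \notin X -> o x = sigma ->
     att x \in iter n (attr_step g sigma S X) set0) ->
  play_in S p ->
  (forall n, N <= n -> p n \in attr g sigma S X -> p n \notin X ->
     o (p n) = sigma -> p n.+1 = att (p n)) ->
  forall k, N <= k -> p k \in attr g sigma S X ->
  exists2 n, k <= n & p n \in X.
Proof.
move=> attP pS patt k + pk.
have [r] : exists r, p k \in iter r (attr_step g sigma S X) set0 by exists #|T|.
elim: r k pk => [|r IHr] k pk; first by rewrite inE.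
move=> pkr Nk; have [pX|pX] := boolP (p k \in X); first by exists k.
suff pk1 : p k.+1 \in iter r (attr_step g sigma S X) set0.
  have [||n kn pn] := IHr k.+1 _ pk1; last by exists n; rewrite // ltnW.
    apply: subsetP pk1.
    exact: (iter_sub_fix (@attr_step_mono _ g sigma S X) r).
  exact: leqW.
have [ok|ok] := eqVneq (o (p k)) sigma; first by rewrite patt //; apply: attP.
move: pkr; rewrite /= inE (negbTE pX) (negbTE ok) => /andP[_ /forall_inP].
by have [_ epk] := pS k; have [pk1S _] := pS k.+1 => /(_ _ pk1S); rewrite epk.
Qed.

(** A play that enters [D] stays there, since the opponent cannot leave and [fD] does not. A play
    that never enters [D] avoids its whole attractor, so it lies in [S :\: A], where [f1] wins. *)
Lemma winss_dominion (x0 : T) sigma S D A : live g S ->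
  gtrap g (~~ sigma) D S -> D \subset A -> A \subset attr g sigma S D ->
  winss sigma D -> winss sigma (S :\: A) -> winss sigma S.
Proof.
move=> liveS [DS D1 D2] DA Aattr [fD legD winD] [f1 leg1 win1].
have [att [attS attP]] := attr_move sigma D liveS.
(* [m.1] is the history since the last entry into [D], where [fD] expects to start; [m.2] is the
   whole history, the right one for [f1] as long as the attractor has been avoided. *)
pose upd (m : seq T * seq T) x :=
  (if x \in D then rcons m.1 x else [::], rcons m.2 x).
pose out (m : seq T * seq T) x :=
  if x \in D then fD m.1
  else if x \in attr g sigma S D then att x else f1 m.2.
have outSA x : x \in S -> x \notin attr g sigma S D -> x \in S :\: A.
  by move=> xS xA; rewrite inE xS andbT; apply: contra xA; apply: subsetP.
apply: (@winss_machine x0 _ _ _ ([::], [::]) upd out) => [m x xS ox|].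
  rewrite /out /upd /=; case: (boolP (x \in D)) => [xD|_].
    by have [fS ?] := legD m.1 x xD ox; split=> //; apply: (subsetP DS).
  case: ifP => [_|/negbT xA]; first exact: attS.
  by have [/setDP[? _] ?] := leg1 m.2 x (outSA x xS xA) ox.
move=> p ms pS ms0 msS mv.
have [[N pN]|noD] := pselect (exists n, p n \in D).
  have [j jD jmin] := find_ex_minn (ex_intro (fun n => p n \in D) N pN).
  have inD n : j <= n -> p n \in D.
    move/subnKC <-; elim: (n - j) => [|i IHi]; first by rewrite addn0.
    rewrite addnS; have [pi epi] := pS (j + i); have [pi1 _] := pS (j + i).+1.
    have [oi|/negb_neq oi] := eqVneq (o (p (j + i))) sigma; last exact: D1 epi.
    rewrite mv // /out IHi.
    have [h ->] : exists h, (ms (j + i)).1 = rcons h (p (j + i)).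
      case: (j + i) IHi => [|k] kD; first by rewrite ms0 /= kD; exists [::].
      by rewrite msS /= kD; eexists.
    by case: (legD h _ IHi oi).
  have hist i : (ms (j + i)).1 = mkseq (shift p j) i.+1.
    elim: i => [|i IHi].
      rewrite addn0; case: j jD jmin {inD} => [|j] jD jmin.
        by rewrite ms0 /= jD.
      rewrite msS /= jD; suff -> : (ms j).1 = [::] by rewrite /mkseq /= /shift addn0.
      have pj : p j \notin D by apply/negP => /jmin; rewrite ltnn.
      by case: j jD jmin pj => [|j] _ _ pj; rewrite ?ms0 ?msS /= (negbTE pj).
    by rewrite addnS msS /= -addnS inD ?leq_addr // IHi [in RHS]mkseqS.
  rewrite -(inf_set_shift p j); apply: winD => i.
    by rewrite inD ?leq_addr //; have [_] := pS (j + i); rewrite -addnS.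
  by move=> oi; rewrite /shift addnS mv // /out inD ?leq_addr // hist.
have nD n : p n \notin D by apply/negP=> pn; apply: noD; exists n.
have nA n : p n \notin attr g sigma S D.
  apply/negP=> pn.
  have [|m _ pm] := attr_reach (N := 0) attP pS _ (leq0n n) pn.
    by move=> k _ pk kD ok; rewrite mv // /out (negbTE kD) pk.
  by case/negP: (nD m).
have hist n : (ms n).2 = mkseq p n.+1.
  elim: n => [|n IHn]; first by rewrite ms0.
  by rewrite msS /= IHn [in RHS]mkseqS.
apply: win1 => n; first by have [pn epn] := pS n; rewrite outSA.
by move=> on; rewrite mv // /out (negbTE (nD n)) (negbTE (nA n)) hist.
Qed.

(** The winner aims at the vertices of [S] in cyclic order, by attraction inside the attractor of
    the current target and by the strategy for its complement outside. If the target changes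
    forever, all of [S] recurs, which is good; otherwise the play finally stays outside one
    attractor and follows one strategy. *)
Lemma winss_top (x0 : T) sigma S : live g S -> good g sigma S ->
  (forall a, a \in S -> winss sigma (S :\: attr g sigma S [set a])) ->
  winss sigma S.
Proof.
move=> liveS goodS win.
have /choice[att attP] := fun a => attr_move sigma [set a] liveS.
have /choice[f fP] : forall a, exists f : strategy T, a \in S ->
    strategy_in sigma (S :\: attr g sigma S [set a]) f /\
    winning_in sigma (S :\: attr g sigma S [set a]) f.
  move=> a; case: (boolP (a \in S)) => [/win[h]|_]; first by exists h.
  by exists (fun=> x0).
pose target k := nth x0 (enum S) (k %% #|S|).
have targetS k x : x \in S -> target k \in S.
  move=> xS; rewrite -mem_enum mem_nth // -cardE ltn_mod card_gt0.
  by apply/set0Pn; exists x.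
pose A k := attr g sigma S [set target k].
(* The counter advances on a visit to its target. The history is emptied inside the attractor and
   restarted at the current vertex when the target changes. *)
pose upd (m : nat * seq T) x :=
  let k := if x == target m.1 then m.1.+1 else m.1 in
  (k, if x \in A k then [::]
      else if x == target m.1 then [:: x] else rcons m.2 x).
pose out (m : nat * seq T) x :=
  if x \in A m.1 then att (target m.1) x else f (target m.1) m.2.
have outSA x k : x \in S -> x \notin A k -> x \in S :\: A k.
  by move=> xS xA; rewrite inE xS xA.
apply: (@winss_machine x0 _ _ _ (0, [::]) upd out) => [m x xS ox|].
  rewrite /out; set k := (upd m x).1; case: ifP => [xA|/negbT xA].
    by apply: (attP _).1.
  have [h ->] : exists h, (upd m x).2 = rcons h x.
    rewrite /= -/k (negbTE xA); case: ifP => _; first by exists [::].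
    by exists m.2.
  have [leg _] := fP _ (targetS k x xS).
  by have [/setDP[? _] ?] := leg h x (outSA x k xS xA) ox.
move=> p ms pS ms0 msS mv.
have step1 n : (ms n.+1).1 =
    if p n.+1 == target (ms n).1 then (ms n).1.+1 else (ms n).1 by rewrite msS.
have mono m n : m <= n -> (ms m).1 <= (ms n).1.
  move/subnKC <-; elim: (n - m) => [|i IHi]; first by rewrite addn0.
  by rewrite addnS step1; case: ifP => _ //; apply: leqW.
have [[N constN]|nconst] :=
    pselect (exists N, forall n, N <= n -> (ms n).1 = (ms N).1).
  set K := (ms N).1 in constN.
  have notK n : N < n -> p n != target K.
    case: n => // n Nn; apply/negP=> pn; have := constN n.+1 (leqW Nn).
    by rewrite step1 constN // pn => /eqP; rewrite eqn_leq ltnn.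
  have notA n : N < n -> p n \notin A K.
    move=> Nn; apply/negP=> pnA.
    have [|m nm] := attr_reach (N := N.+1) (attP (target K)).2 pS _ Nn pnA.
      by move=> k Nk pkA _ ok; rewrite mv // /out constN ?(ltnW Nk) // pkA.
    by rewrite inE (negbTE (notK m (leq_trans Nn nm))).
  have [|j [jP jmin]] :=
      @stable_from (fun n => (ms n).1 = K /\ p n \notin A K) N.+1.
    by move=> n Nn; rewrite constN ?notA // ltnW.
  (* Unless [j] is 0, either the counter differed just before, so a target was hit at [j] and the
     history restarted, or that vertex lay in the attractor, so the history was empty. *)
  have histj : (ms j).2 = [:: p j].
    have [msj pj] := jP j (leqnn j).
    case: j jP jmin msj pj => [|j] jP jmin msj pj.
      rewrite ms0 /upd /= in msj *; rewrite msj (negbTE pj).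
      by case: ifP.
    case: jmin => // /= jmin; rewrite msS /upd /= -step1 msj (negbTE pj).
    case: ifP => // pjt; rewrite step1 pjt in msj.
    suff -> : (ms j).2 = [::] by [].
    have pjA : p j \in A K by apply/negPn/negP=> pjA; apply: jmin.
    case: j {jP jmin pj pjt} msj pjA => [|j] msj pjA.
      by rewrite ms0 /upd /= in msj *; rewrite msj pjA.
    by rewrite msS /upd /= -step1 msj pjA.
  have hist i : (ms (j + i)).2 = mkseq (shift p j) i.+1.
    elim: i => [|i IHi]; first by rewrite addn0 histj /mkseq /= /shift addn0.
    have [m1 _] := jP (j + i) (leq_addr _ _).
    have [m2 p2] := jP (j + i).+1 (leqW (leq_addr _ _)).
    rewrite addnS msS /upd /= -step1 m2 (negbTE p2) IHi [in RHS]mkseqS.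
    case: ifP => [pt|_]; last by rewrite /shift addnS.
    by move: m2; rewrite step1 pt m1 => /eqP; rewrite eqn_leq ltnn.
  rewrite -(inf_set_shift p j); have [_ winK] := fP _ (targetS K _ (pS 0).1).
  apply: winK => i.
    have [m1 p1] := jP (j + i) (leq_addr _ _); have [pi epi] := pS (j + i).
    by rewrite /shift addnS; split=> //; apply: outSA.
  move=> oi; have [m1 p1] := jP (j + i) (leq_addr _ _).
  by rewrite {1}/shift addnS mv // /out m1 (negbTE p1) hist.
suff -> : inf_set p = S by [].
apply/setP=> a; apply/idP/idP=> [|aS].
  by rewrite inE => /asboolP/(_ 0)[n _ <-]; case: (pS n).
have unbounded k : exists n, k <= (ms n).1.
  elim: k => [|k [n kn]]; first by exists 0.
  have [//|/forallNP nk] := pselect (exists n, k < (ms n).1).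
  case: nconst; exists n => m nm; apply/eqP; rewrite eqn_leq (mono _ _ nm) andbT.
  by rewrite (leq_trans _ kn) // leqNgt; apply/negP/nk.
rewrite inE; apply/asboolP=> m.
(* The counter value [k] has target [a] and is at least the value at time [m]. The counter grows by
   steps of one, so it must pass [k], which happens at a visit to [a]. *)
pose k := index a (enum S) + (ms m).1 * #|S|.
have S0 : 0 < #|S| by apply/card_gt0P; exists a.
have tk : target k = a.
  rewrite /target /k addnC modnMDl modn_small ?nth_index ?mem_enum //.
  by rewrite cardE index_mem mem_enum.
have [n kn] := unbounded k.+1.
have [l kl lmin] := find_ex_minn (ex_intro (fun n => k < (ms n).1) n kn).
have mk : (ms m).1 <= k.
  rewrite /k -{1}[(ms m).1]muln1 (leq_trans _ (leq_addl _ _)) //.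
  by rewrite leq_mul2l S0 orbT.
have ml : m < l.
  by rewrite ltnNge; apply/negP=> /mono; rewrite leqNgt (leq_ltn_trans mk kl).
case: l kl lmin ml => // l kl lmin ml.
have lk : (ms l).1 <= k by rewrite leqNgt; apply/negP=> /lmin; rewrite ltnn.
move: kl; rewrite step1; case: ifP => [/eqP pl kl|_]; last by rewrite ltnNge lk.
exists l.+1; first exact: ltnW.
by rewrite pl -tk; congr target; apply/eqP; rewrite eqn_leq lk.
Qed.

Lemma winsr_winss (x0 : T) sigma S : winsr g sigma S -> winss sigma S.
Proof.
elim=> {S} [|S D A liveS trD DA Aattr _ winD _ winSA|S liveS goodS _ win].
- by exists (fun=> x0) => [h x|p /(_ 0)[]]; rewrite inE.
- exact: winss_dominion winD winSA.
- exact: winss_top.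
Qed.

(** The two strategies played against each other produce a play inside [D] that would be good for
    both players. *)
Lemma winsr_disjoint sigma S D : winsr g sigma S -> gtrap g sigma D S ->
  winsr g (~~ sigma) D -> D = set0.
Proof.
move=> winS [DS D1 D2] winD; apply/eqP/negPn/negP => /set0Pn[x xD].
have [f legf wf] := winsr_winss x winS; have [h legh wh] := winsr_winss x winD.
have [p p0 pS] := history_play x (fun s y => if o y == sigma then f s else h s).
have pD n : p n \in D.
  elim: n => [|n pn]; first by rewrite p0.
  rewrite pS mkseqS; have [on|/negb_neq on] := eqVneq (o (p n)) sigma.
    by have [fS ef] := legf (mkseq p n) _ (subsetP DS _ pn) on; apply: D1 ef.
  by have [] := legh (mkseq p n) _ pn on.
have ep n : e (p n) (p n.+1).
  rewrite pS mkseqS; have [on|/negb_neq on] := eqVneq (o (p n)) sigma.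
    by have [] := legf (mkseq p n) _ (subsetP DS _ (pD n)) on.
  by have [] := legh (mkseq p n) _ (pD n) on.
have gf : good g sigma (inf_set p).
  apply: wf => n; first by rewrite (subsetP DS).
  by move=> on; rewrite pS on eqxx.
have gh : good g (~~ sigma) (inf_set p).
  by apply: wh => n // on; rewrite pS on; case: (sigma).
by move: gf gh; rewrite /good addbN => ->.
Qed.

Lemma winsr_gtrap sigma S D : winsr g sigma S -> gtrap g sigma D S ->
  winsr g sigma D.
Proof.
move=> winS trD; have liveD := live_gtrap (winsr_live winS) trD.
have [P [trP winP trC winC]] := split_exists sigma liveD.
have := winsr_disjoint winS (gtrap_trans trC trD) winC.
move=> /eqP; rewrite setD_eq0 => DP.
by suff -> : D = P by []; apply/eqP; rewrite eqEsubset DP; case: trP.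
Qed.

Lemma winsr_or_dominion sigma S : live g S -> winsr g sigma S \/
  exists D, [/\ D != set0, gtrap g sigma D S, winsr g (~~ sigma) D &
                good g (~~ sigma) D].
Proof.
move=> liveS; have [P [trP winP trC winC]] := split_exists sigma liveS.
have [/eqP|C0] := eqVneq (S :\: P) set0.
  rewrite setD_eq0 => SP; left.
  by suff -> : S = P by []; apply/eqP; rewrite eqEsubset SP; case: trP.
right; have [D [D0 trD winD goodD]] := winsr_dominion winC C0.
by rewrite negbK in trD; exists D; split=> //; apply: gtrap_trans trD trC.
Qed.
End Soundness.

(** * Horn's construction on regions *)

Section Agreement.
Variables (T : finType) (g1 g2 : tgame T).
Implicit Types (S D X P : {set T}) (sigma : bool).

Definition agree S := forall x, x \in S ->
  owner g1 x = owner g2 x /\ forall y, y \in S -> edge g1 x y = edge g2 x y.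

Lemma agree_sub S P : P \subset S -> agree S -> agree P.
Proof.
move=> /subsetP PS agS x /PS/agS[ox ex].
by split=> // y /PS; apply: ex.
Qed.

Lemma live_agree S : agree S -> live g1 S -> live g2 S.
Proof.
move=> agS liveS x xS; have [y yS exy] := liveS x xS; exists y => //.
by rewrite -(agS x xS).2.
Qed.

Lemma gtrap_agree sigma D S : agree S -> gtrap g1 sigma D S -> gtrap g2 sigma D S.
Proof.
move=> agS [DS D1 D2]; split=> // [x y xD|x xD]; have xS := subsetP DS x xD.
  by have [<- eq_e] := agS x xS; move=> ox yS; rewrite -eq_e //; apply: D1.
have [<- eq_e ox] := agS x xS; have [y yD exy] := D2 x xD ox.
by exists y => //; rewrite -eq_e // (subsetP DS).
Qed.

Lemma attr_agree sigma S X : agree S -> attr g1 sigma S X = attr g2 sigma S X.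
Proof.
move=> agS; rewrite /attr /fixset; elim: #|T| => //= n ->.
have : iter n (attr_step g2 sigma S X) set0 \subset S.
  case: n => [|n]; first by rewrite sub0set.
  by apply/subsetP=> x; rewrite inE => /andP[].
move: (iter n _ _) => Y /subsetP YS; apply/setP=> x; rewrite !inE.
case: (boolP (x \in S)) => //= xS; have [-> eq_e] := agS x xS.
congr (_ || _); case: ifP => _.
  apply: eq_existsb => y; case: (boolP (y \in Y)) => //= yY.
  by rewrite eq_e ?YS.
by apply: eq_forallb => y; case: (boolP (y \in S)) => //= yS; rewrite eq_e.
Qed.

(* Only the regions of [S] to which [WinsTop] applies matter, hence the premise
   [winsr g1 sigma X]; it makes the deletion of a winning set an instance. *)
Lemma winsr_agree sigma S : agree S ->
  (forall X, X \subset S -> X != set0 -> winsr g1 sigma X -> good g1 sigma X ->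
     good g2 sigma X) ->
  winsr g1 sigma S -> winsr g2 sigma S.
Proof.
move=> + + winS; elim: winS => {S} [|S D A liveS trD DA Aattr winD IHD winSA IHSA
  |S liveS goodS win IH] agS good12.
- exact: WinsEmpty.
- have [DS _ _] := trD.
  apply: (@WinsDominion _ _ _ S D A); rewrite -?attr_agree //.
  + exact: live_agree.
  + exact: gtrap_agree.
  + apply: IHD (agree_sub DS agS) _ => X XD.
    by apply: good12; apply: subset_trans DS.
  + apply: IHSA (agree_sub (subsetDl _ _) agS) _ => X XD.
    by apply: good12; apply: subset_trans XD (subsetDl _ _).
- have [->|S0] := eqVneq S set0; first exact: WinsEmpty.
  apply: WinsTop; first exact: live_agree.
    by apply: good12 => //; apply: WinsTop.
  move=> a aS; rewrite -attr_agree //.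
  apply: IH aS (agree_sub (subsetDl _ _) agS) _ => X XD.
  by apply: good12; apply: subset_trans XD (subsetDl _ _).
Qed.

End Agreement.

Lemma agree_sym (T : finType) (g1 g2 : tgame T) S : agree g1 g2 S -> agree g2 g1 S.
Proof.
move=> ag x xS; have [ox ex] := ag x xS.
by split=> // y yS; rewrite ex.
Qed.

(** * The old game [g] and the new game [h] *)

Section Horn.
Variables (T : finType) (g h : tgame T) (W : {set T}) (w : T).
Implicit Types (S D E P Q X : {set T}).

Definition exits : {set T} :=
  [set y | (y \notin W) && [exists u in W, owner g u && edge g u y]].

(** The game on [W] behind forced-connectedness. *)
Definition single : tgame T := TGame (edge g) (owner g) (pred1 W).

(** Both games share the vertex type, and no other vertex leads to [w] in [g]. The last three
    hypotheses come from [W] being forced-connected, containing a vertex from which player 0 can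
    enter [w], and not being a 1-trap. *)
Hypothesis owner_h : forall x, x != w -> owner h x = owner g x.
Hypothesis owner_w : owner h w = true.
Hypothesis edge_h : forall x y, x != w -> y != w -> edge h x y = edge g x y.
Hypothesis edge_hw : forall x, x != w -> edge h x w = (x \in W) && ~~ owner g x.
Hypothesis edge_wh : forall y, edge h w y = (y \in exits).
Hypothesis edge_gw : forall x, x != w -> edge g x w = false.
Hypothesis winning_h : forall X, w \notin X ->
  winning h X = winning g X && ~~ (W \subset X).
Hypothesis winning_hw : forall X, w \notin X ->
  winning h (w |: X) = winning g X && (W \proper X).
Hypothesis wNW : w \notin W.
Hypothesis winning_W : winning g W.
Hypothesis winsr_W : winsr single false W.
Hypothesis W_owner0 : exists2 x, x \in W & owner g x = false.
Hypothesis exits_neq0 : exits != set0.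

Lemma notin_neq S x : w \notin S -> x \in S -> x != w.
Proof. by move=> wS xS; apply: contraNneq wS => <-. Qed.

Lemma exits_neq y : y \in exits -> y != w.
Proof.
rewrite inE => /andP[_ /'exists_andP[u [uW /andP[_ euy]]]].
by apply: contraTneq euy => ->; rewrite edge_gw // (notin_neq wNW).
Qed.

Lemma agree_gh S : w \notin S -> agree g h S.
Proof.
move=> wS x xS; rewrite owner_h ?(notin_neq wS) //; split=> // y yS.
by rewrite edge_h ?(notin_neq wS).
Qed.

Lemma agree_hg S : w \notin S -> agree h g S.
Proof. by move/agree_gh/agree_sym. Qed.

(** Among sets without [w], the new game only loses winning sets, namely those containing [W]. Hence
    two of the four transfers are free and the other two ask for [~~ (W \subset S)]. *)
Lemma winsr_hg0 S : w \notin S -> winsr h false S -> winsr g false S.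
Proof.
move=> wS; apply: winsr_agree (agree_hg wS) _ => X XS _ _.
rewrite /good !addbF winning_h; first by case/andP.
by apply: contra wS; apply: subsetP.
Qed.

Lemma winsr_gh1 S : w \notin S -> winsr g true S -> winsr h true S.
Proof.
move=> wS; apply: winsr_agree (agree_gh wS) _ => X XS _ _.
rewrite /good !addbT winning_h ?negb_and; first by move->.
by apply: contra wS; apply: subsetP.
Qed.

Lemma winsr_gh0 S : w \notin S -> ~~ (W \subset S) ->
  winsr g false S -> winsr h false S.
Proof.
move=> wS WS; apply: winsr_agree (agree_gh wS) _ => X XS _ _.
rewrite /good !addbF winning_h; last by apply: contra wS; apply: subsetP.
by move->; apply: contra WS => /subset_trans; apply.
Qed.

Lemma winsr_hg1 S : w \notin S -> ~~ (W \subset S) ->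
  winsr h true S -> winsr g true S.
Proof.
move=> wS WS; apply: winsr_agree (agree_hg wS) _ => X XS _ _.
rewrite /good !addbT winning_h; last by apply: contra wS; apply: subsetP.
rewrite negb_and negbK => /orP[//|/subset_trans/(_ XS) WS'].
by rewrite WS' in WS.
Qed.

Lemma winsr_gW : winsr g false W.
Proof.
apply: winsr_agree winsr_W => // X _ _ _.
by rewrite /good /= addbF => /eqP->; rewrite addbF.
Qed.

Lemma W_neq0 : W != set0.
Proof. by have [x xW _] := W_owner0; apply/set0Pn; exists x. Qed.

(** Player 0 wins [E] in [single] too, so [E] contains a dominion that is good for player 0 there,
    and only [W] is. *)
Lemma gtrap_W E : gtrap g false E W -> E != set0 -> E = W.
Proof.
move=> trE E0; have winE := winsr_gtrap winsr_W (trE : gtrap single false E W).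
have [D [D0 [DE _ _] _]] := winsr_dominion winE E0.
rewrite /good addbF => /eqP DW.
by apply/eqP; rewrite eqEsubset -{2}DW DE andbT; case: trE.
Qed.

(* Otherwise player 1 keeps the play in [W :&: Q], so that [W] is a part of [Q]
   that player 1 cannot leave and in which player 0 wins. *)
Lemma exitless_disjoint Q X : winsr g true Q -> gtrap g false Q X ->
  W \subset X -> exits :&: Q = set0 -> W :&: Q = set0.
Proof.
move=> winQ [QX Q1 Q2] /subsetP WX exQ; apply/eqP/negPn/negP=> WQ0.
have noexit x y : x \in W -> owner g x = true -> y \in Q -> edge g x y -> y \in W.
  move=> xW ox yQ exy; apply/negPn/negP=> yW; have := in_set0 y.
  rewrite -exQ !inE yW yQ andbT => /negbT/negP; apply => /=.
  by apply/existsP; exists x; rewrite xW ox.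
have liveW := winsr_live winsr_W.
have WQ : W :&: Q = W.
  apply: gtrap_W => //; split=> [|x y|x]; first exact: subsetIl.
    move=> /setIP[xW xQ] ox yW exy; rewrite inE yW.
    exact: Q1 ox (WX _ yW) exy.
  move=> /setIP[xW xQ] ox; have [y yQ exy] := Q2 x xQ ox.
  by exists y => //; rewrite inE yQ (noexit x).
move/setIidPl: WQ => WQ.
have trW : gtrap g true W Q.
  by split=> // x xW ox; apply: liveW.
by have := winsr_disjoint winQ trW winsr_gW; apply/eqP/W_neq0.
Qed.

Lemma live_h S : w \notin S -> live g S -> exits :&: S != set0 -> live h (w |: S).
Proof.
move=> wS liveS /set0Pn[y /setIP[yex yS]] x /setU1P[->|xS].
  by exists y; rewrite ?edge_wh // setU1r.
have [z zS exz] := liveS x xS; exists z; first by rewrite setU1r.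
by rewrite edge_h ?(notin_neq wS).
Qed.

(** If a player 0 dominion [D] contains [w], its remainder [X] is winning in [g] and contains [W].
    Player 0 then wins [X] in [g] by [WinsTop]: a part that player 1 wins outside some attractor
    would also be won by player 1 within [D], together with [w] by induction if it has an exit, and
    without [w] otherwise. *)
Lemma winsr_horn1 S : w \notin S -> winsr g true S -> exits :&: S != set0 ->
  winsr h true (w |: S).
Proof.
have [n] := ubnP #|S|; elim: n S => // n IHn S leSn wS winS exS.
have liveS := winsr_live winS.
have [//|[D [D0 trD winD goodD]]] := winsr_or_dominion true (live_h wS liveS exS).
exfalso; have [/subsetP DS D1 D2] := trD; rewrite /= in winD goodD.
have inS x : x \in D -> x != w -> x \in S.
  by move=> /DS /setU1P[->|//]; rewrite eqxx.
have [wD|wD] := boolP (w \in D); last first.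
  have trD' : gtrap g true D S.
    split=> [|x y xD ox yS exy|x xD ox].
    - by apply/subsetP=> x xD; rewrite inS ?(notin_neq wD).
    - have xw := notin_neq wD xD; have yw := notin_neq wS yS.
      by apply: (D1 x); rewrite ?owner_h ?edge_h ?setU1r.
    - have [|y yD exy] := D2 x xD; first by rewrite owner_h ?(notin_neq wD).
      by exists y; rewrite // -edge_h ?(notin_neq wD).
  have := winsr_disjoint winS trD' (winsr_hg0 wD winD).
  exact/eqP.
set X := D :\ w; have wX : w \notin X by rewrite !inE eqxx.
have DE : D = w |: X by rewrite setD1K.
have XS : X \subset S by apply/subsetP=> x /setD1P[xw xD]; apply: inS.
move: goodD; rewrite /good addbF DE winning_hw // => /andP[winX ltWX].
have WX := proper_sub ltWX.
have trX : gtrap g true X S.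
  split=> // [x y /setD1P[xw xD] ox yS exy|x /setD1P[xw xD] ox].
    rewrite !inE (notin_neq wS) //=; apply: (D1 x) => //.
    - by rewrite owner_h.
    - by rewrite setU1r.
    - by rewrite edge_h // (notin_neq wS).
  have [|y yD exy] := D2 x xD; first by rewrite owner_h.
  have [yw|yw] := eqVneq y w; last by exists y; rewrite ?inE ?yw -?edge_h.
  (* A move to [w] starts in [W], and is replaced in [g] by a move inside [W], a subset of [X]. *)
  move: exy; rewrite yw edge_hw // => /andP[xW _].
  have [z zW exz] := winsr_live winsr_W xW.
  by exists z => //; apply: (subsetP WX).
suff winX' : winsr g false X.
  have := winsr_disjoint winS trX winX' => X0.
  by have := W_neq0; rewrite -subset0 -X0 WX.
apply: WinsTop => [||a aX]; first exact: live_gtrap trX.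
  by rewrite /good addbF.
have liveX := live_gtrap liveS trX.
have trQ := gtrap_attrC false [set a] liveX.
have ltQ := @card_attrC _ g false _ [set a] _ aX (set11 a).
set Q := X :\: _ in trQ ltQ *.
have [//|[Q1 [Q10 trQ1 winQ1 _]]] := winsr_or_dominion false (live_gtrap liveX trQ).
exfalso; rewrite /= in winQ1; have [Q1Q _ _] := trQ1.
have {}trQ1 := gtrap_trans trQ1 trQ.
have ltQ1 : #|Q1| < n.
  apply: leq_ltn_trans (subset_leq_card Q1Q) (leq_trans ltQ _).
  by rewrite -ltnS (leq_ltn_trans (subset_leq_card XS)).
have [/subsetP Q1X tr1 tr2] := trQ1.
have wQ1 : w \notin Q1 by apply: contra wX; apply: Q1X.
have [exQ|exQ] := eqVneq (exits :&: Q1) set0; last first.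
  have winQ1' := IHn Q1 ltQ1 wQ1 winQ1 exQ.
  have tr : gtrap h false (w |: Q1) D.
    split=> [|x y /setU1P[->|xQ]|x /setU1P[->|xQ]]; rewrite ?owner_w //.
    - rewrite DE; apply: setUS; exact/subsetP.
    - have xw := notin_neq wQ1 xQ; rewrite DE owner_h // => ox /setU1P[->|yX].
        by rewrite setU11.
      rewrite edge_h ?(notin_neq wX yX) // => exy.
      by rewrite setU1r // (tr1 x).
    - case/set0Pn: exQ => y /setIP[yex yQ] _.
      by exists y; rewrite ?edge_wh ?setU1r.
    - have xw := notin_neq wQ1 xQ; rewrite owner_h // => ox.
      have [y yQ exy] := tr2 x xQ ox; exists y; first by rewrite setU1r.
      by rewrite edge_h // (notin_neq wQ1).
  have := winsr_disjoint winD tr winQ1'.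
  by move/setP/(_ w); rewrite !inE eqxx.
(* Disjointness from [W] removes all edges from [Q1] to [w]. *)
have WQ1 := exitless_disjoint winQ1 trQ1 WX exQ.
have tr : gtrap h false Q1 D.
  split=> [|x y xQ|x xQ].
  - by apply/subsetP=> x /Q1X; rewrite DE => xX; rewrite setU1r.
  - have xw := notin_neq wQ1 xQ; rewrite DE owner_h // => ox /setU1P[->|yX].
      rewrite edge_hw // => /andP[xW _]; have := in_set0 x.
      by rewrite -WQ1 inE xW xQ.
    by rewrite edge_h ?(notin_neq wX yX) //; apply: tr1.
  - have xw := notin_neq wQ1 xQ; rewrite owner_h // => ox.
    have [y yQ exy] := tr2 x xQ ox; exists y => //.
    by rewrite edge_h // (notin_neq wQ1).
have := winsr_disjoint winD tr (winsr_gh1 wQ1 winQ1).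
exact/eqP.
Qed.

(** Let a player 1 dominion [D] contain [w]. Parts of [X] that player 0 wins and player 1 cannot
    leave must contain [W], as others would survive in [h]. A winning such part [P] contains all
    exits in [X] and differs from [X], which is not winning; by induction player 0 wins it together
    with [w]. *)
Lemma winsr_horn0 S : w \notin S -> winsr g false S -> exits :&: S != set0 ->
  winsr h false (w |: S).
Proof.
have [n] := ubnP #|S|; elim: n S => // n IHn S leSn wS winS exS.
have liveS := winsr_live winS.
have [//|[D [D0 trD winD goodD]]] := winsr_or_dominion false (live_h wS liveS exS).
exfalso; have [/subsetP DS D1 D2] := trD; rewrite /= in winD goodD.
have inS x : x \in D -> x != w -> x \in S.
  by move=> /DS /setU1P[->|//]; rewrite eqxx.
have [wD|wD] := boolP (w \in D); last first.
  have trD' : gtrap g false D S.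
    split=> [|x y xD ox yS exy|x xD ox].
    - by apply/subsetP=> x xD; rewrite inS ?(notin_neq wD).
    - have xw := notin_neq wD xD; have yw := notin_neq wS yS.
      by apply: (D1 x); rewrite ?owner_h ?edge_h ?setU1r.
    - have [|y yD exy] := D2 x xD; first by rewrite owner_h ?(notin_neq wD).
      by exists y; rewrite // -edge_h ?(notin_neq wD).
  (* Otherwise player 0 could leave [D] for [w] from a vertex of [W]. *)
  have WD : ~~ (W \subset D).
    have [x xW ox] := W_owner0; apply/negP=> /subsetP/(_ x xW) xD.
    case/negP: wD; apply: (D1 x) => //; last 1 first.
    - by rewrite edge_hw ?(notin_neq wNW) // xW ox.
    - by rewrite owner_h ?(notin_neq wNW).
    - exact: setU11.
  have := winsr_disjoint winS trD' (winsr_hg1 wD WD winD).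
  exact/eqP.
set X := D :\ w; have wX : w \notin X by rewrite !inE eqxx.
have DE : D = w |: X by rewrite setD1K.
have XS : X \subset S by apply/subsetP=> x /setD1P[xw xD]; apply: inS.
have trX : gtrap g false X S.
  split=> // [x y /setD1P[xw xD] ox yS exy|x /setD1P[xw xD] ox].
    rewrite !inE (notin_neq wS) //=; apply: (D1 x) => //.
    - by rewrite owner_h.
    - by rewrite setU1r.
    - by rewrite edge_h // (notin_neq wS).
  have [|y yD exy] := D2 x xD; first by rewrite owner_h.
  have [yw|yw] := eqVneq y w; last by exists y; rewrite ?inE ?yw -?edge_h.
  by move: exy; rewrite yw edge_hw // ox andbF.
have winX := winsr_gtrap winS trX; have liveX := winsr_live winX.
have exX : exits :&: X != set0.
  have [|y yD] := D2 w wD; first by rewrite owner_w.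
  rewrite edge_wh => yex; apply/set0Pn; exists y.
  by rewrite !in_setI yex in_setD1 yD exits_neq.
have X0 : X != set0.
  by apply: contraNneq exX => ->; rewrite setI0.
have nodom P : P != set0 -> ~~ (W \subset P) -> gtrap g true P X ->
    winsr g false P -> False.
  move=> P0 WP [/subsetP PX P1 P2] winP.
  have wP : w \notin P by apply: contra wX; apply: PX.
  have tr : gtrap h true P D.
    split=> [|x y xP|x xP].
    - by apply/subsetP=> x /PX; rewrite DE => xX; rewrite setU1r.
    - have xw := notin_neq wP xP; rewrite DE owner_h // => ox /setU1P[->|yX].
        by rewrite edge_hw // ox andbF.
      by rewrite edge_h ?(notin_neq wX yX) //; apply: P1.
    - have xw := notin_neq wP xP; rewrite owner_h // => ox.
      have [y yP exy] := P2 x xP ox; exists y => //.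
      by rewrite edge_h // (notin_neq wP).
  have := winsr_disjoint winD tr (winsr_gh0 wP WP winP).
  exact/eqP.
have [WX|WX] := boolP (W \subset X); last first.
  by apply: (nodom X) => //; apply: gtrap_refl.
(* [X] contains an exit, and exits lie outside [W]. *)
have ltWX : W \proper X.
  rewrite properEneq WX andbT; apply: contraNneq exX => <-.
  by apply/eqP/setP=> y; rewrite !inE; case: (y \in W); rewrite ?andbF.
move: goodD; rewrite /good addbT DE winning_hw // ltWX andbT => winXF.
have [P [P0 trP winP goodP]] := winsr_dominion winX X0.
have [PX P1 P2] := trP; have wP : w \notin P by apply: contra wX; apply: subsetP.
have [WP|WP] := boolP (W \subset P); last exact: (nodom P).
have exP y : y \in exits -> y \in X -> y \in P.
  rewrite inE => /andP[_ /'exists_andP[u [uW /andP[ou euy]]]] yX.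
  by apply: (P1 u) => //; apply: (subsetP WP).
have ltP : #|P| < n.
  rewrite -ltnS; apply: leq_trans leSn; rewrite ltnS.
  apply: leq_trans (subset_leq_card XS); apply: proper_card.
  rewrite properEneq PX andbT; apply: contraNneq winXF => <-.
  by move: goodP; rewrite /good addbF.
have exP0 : exits :&: P != set0.
  case/set0Pn: exX => y /setIP[yex yX]; apply/set0Pn; exists y.
  by rewrite inE yex exP.
have winP' := IHn P ltP wP winP exP0.
have tr : gtrap h true (w |: P) D.
  split=> [|x y /setU1P[->|xP]|x /setU1P[->|xP]]; rewrite ?owner_w //.
  - by rewrite DE; apply: setUS.
  - rewrite DE => _ /setU1P[->|yX]; first by rewrite setU11.
    by rewrite edge_wh => yex; rewrite setU1r // exP.
  - have xw := notin_neq wP xP; rewrite DE owner_h // => ox /setU1P[->|yX].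
      by rewrite setU11.
    rewrite edge_h ?(notin_neq wX yX) // => exy.
    by rewrite setU1r // (P1 x).
  - have xw := notin_neq wP xP; rewrite owner_h // => ox.
    have [y yP exy] := P2 x xP ox; exists y; first by rewrite setU1r.
    by rewrite edge_h // (notin_neq wP).
have := winsr_disjoint winD tr winP'.
by move/setP/(_ w); rewrite !inE eqxx.
Qed.

(** Player 1 owns [w] and wins from it as soon as one exit lies in [Q]. If none does, all exits lie
    in [P] and [w] joins player 0. *)
Lemma horn_splits P : splits g false (~: [set w]) P ->
  exists2 P', splits h false setT P' & P' :\ w = P.
Proof.
set V := ~: [set w]; set Q := V :\: P => -[trP winP trQ winQ].
have [PV P1 P2] := trP; have [QV Q1 Q2] := trQ.
rewrite -/Q /= in winP winQ trP trQ P1 P2 QV Q1 Q2.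
have wV : w \notin V by rewrite !inE eqxx.
have inV y : y != w -> y \in V by move=> yw; rewrite !inE.
have wP : w \notin P by apply: contra wV; apply: subsetP.
have wQ : w \notin Q by apply: contra wV; apply: subsetP.
have inPQ y : y != w -> y \notin P -> y \in Q.
  by move=> yw yP; rewrite inE yP inV.
have WV : W \subset V by apply/subsetP=> x /(notin_neq wNW)/inV.
have [exQ|exQ] := eqVneq (exits :&: Q) set0.
  have WQ := exitless_disjoint winQ trQ WV exQ.
  have exP y : y \in exits -> y \in P.
    move=> yex; apply/negPn/negP => /(inPQ _ (exits_neq yex)) yQ.
    by have := in_set0 y; rewrite -exQ in_setI yex yQ.
  have CE : setT :\: (w |: P) = Q.
    by apply/setP=> y; rewrite !inE negb_or andbT andbC.
  exists (w |: P); last by rewrite setU1K.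
  split; rewrite ?CE.
  - split=> [|x y /setU1P[->|xP]|x /setU1P[->|xP]]; rewrite ?owner_w //.
    + by move=> _ _; rewrite edge_wh => /exP yP; rewrite setU1r.
    + have xw := notin_neq wP xP; rewrite owner_h // => ox _.
      have [->|yw] := eqVneq y w; first by rewrite setU11.
      by rewrite edge_h // => exy; rewrite setU1r // (P1 x) ?inV.
    + have xw := notin_neq wP xP; rewrite owner_h // => ox.
      have [y yP exy] := P2 x xP ox; exists y; first by rewrite setU1r.
      by rewrite edge_h // (notin_neq wP).
  - apply: winsr_horn0 => //; case/set0Pn: exits_neq0 => y yex.
    by apply/set0Pn; exists y; rewrite in_setI yex exP.
  - split=> [|x y xQ|x xQ].
    + exact: subsetT.
    + have xw := notin_neq wQ xQ; rewrite owner_h // => ox _.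
      have [->|yw] := eqVneq y w.
        rewrite edge_hw // => /andP[xW _]; have := in_set0 x.
        by rewrite -WQ inE xW xQ.
      by rewrite edge_h // => exy; rewrite (Q1 x) ?inV.
    + have xw := notin_neq wQ xQ; rewrite owner_h // => ox.
      have [y yQ exy] := Q2 x xQ ox; exists y => //.
      by rewrite edge_h // (notin_neq wQ).
  - exact: winsr_gh1.
have CE : setT :\: P = w |: Q.
  apply/setP=> y; rewrite !inE andbT; have [->|_] := eqVneq y w; last by rewrite andbT.
  by rewrite wP.
(* An exit in [Q] is entered from a player 1 vertex of [W], which cannot lie in [P], a trap for
   player 1. *)
have WP : ~~ (W \subset P).
  case/set0Pn: exQ => y /setIP[yex yQ].
  have yV := inV y (exits_neq yex).
  move: yex; rewrite inE => /andP[_ /'exists_andP[u [uW /andP[ou euy]]]].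
  apply/negP=> /subsetP/(_ u uW) uP.
  by have := P1 u y uP ou yV euy; move: yQ; rewrite inE => /andP[/negP].
exists P; last by apply/setDidPl; rewrite disjoint_sym disjoints1.
split; rewrite ?CE.
- split=> [|x y xP|x xP].
  + exact: subsetT.
  + have xw := notin_neq wP xP; rewrite owner_h // => ox _.
    have [->|yw] := eqVneq y w; first by rewrite edge_hw // ox andbF.
    by rewrite edge_h // => exy; rewrite (P1 x) ?inV.
  + have xw := notin_neq wP xP; rewrite owner_h // => ox.
    have [y yP exy] := P2 x xP ox; exists y => //.
    by rewrite edge_h // (notin_neq wP).
- exact: winsr_gh0.
- split=> [|x y /setU1P[->|xQ]|x /setU1P[->|xQ]]; rewrite ?owner_w //.
  + have xw := notin_neq wQ xQ; rewrite owner_h // => ox _.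
    have [->|yw] := eqVneq y w; first by rewrite setU11.
    by rewrite edge_h // => exy; rewrite setU1r // (Q1 x) ?inV.
  + move=> _; case/set0Pn: exQ => y /setIP[yex yQ].
    by exists y; rewrite ?edge_wh ?setU1r.
  + have xw := notin_neq wQ xQ; rewrite owner_h // => ox.
    have [y yQ exy] := Q2 x xQ ox; exists y; first by rewrite setU1r.
    by rewrite edge_h // (notin_neq wQ).
- exact: winsr_horn1.
Qed.

End Horn.

(** * Muller games with dead ends *)

Lemma in_succ (T : finType) (G : arena T) x y :
  (y \in succ G x) = ((x, y) \in edges G).
Proof.
rewrite inE; apply/'exists_andP/idP => [[z [/set1P-> //]]|exy].
by exists x; rewrite set11.
Qed.

Section TotalGame.
Variables (T : finType) (H : game T).
Hypothesis muH : muller_game H.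
Implicit Types (S P Q W X : {set T}) (x y : T) (p : nat -> T) (sigma : bool).

(* Dead ends get a loop, as in [play]; a play that reaches one is won by
   player 1 since no set with a dead end is winning. *)
Definition total_game : tgame T :=
  TGame (fun x y => if succ H x == set0 then y == x else y \in succ H x)
    (fun x => x \in vert1 H)
    (fun X => (X \in Omega H) && [forall x in X, succ H x != set0]).

Local Notation g := total_game.

Lemma succP x y : y \in succ H x ->
  exists sigma, x \in vert_of H sigma /\ y \in vert_of H (~~ sigma).
Proof.
case: muH => _ /subsetP edgeH _; rewrite in_succ => /edgeH.
by rewrite inE => /orP[] /setXP[/= xV yV]; [exists false | exists true].
Qed.

Lemma vert_of_verts sigma x : x \in vert_of H sigma -> x \in verts H.
Proof. by case: sigma; rewrite inE => ->; rewrite ?orbT. Qed.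

Lemma vert_of_owner sigma x : x \in vert_of H sigma -> owner g x = sigma.
Proof.
case: sigma => //= xV; apply/negbTE; case: muH => /disjointFr dis _ _.
by rewrite dis.
Qed.

Lemma owner_vert_of sigma x : succ H x != set0 -> owner g x = sigma ->
  x \in vert_of H sigma.
Proof.
case/set0Pn=> y /succP[rho [xV _]] <-.
by rewrite (vert_of_owner xV).
Qed.

Lemma live_setT : live g setT.
Proof.
move=> x _ /=; have [_|/set0Pn[y]] := eqVneq (succ H x) set0; first by exists x.
by exists y.
Qed.

Lemma edge_dead x y : succ H x = set0 -> edge g x y -> y = x.
Proof. by move=> /= ->; rewrite eqxx => /eqP. Qed.

Lemma edge_succ x y : succ H x != set0 -> edge g x y = (y \in succ H x).
Proof. by move=> /= /negbTE->. Qed.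

Lemma play_edge p : play H p <-> forall n, edge g (p n) (p n.+1).
Proof.
by split=> pl n; move: (pl n) => /=; case: ifP => // _; [move-> | move/eqP].
Qed.

Lemma won0_winning p : play H p -> won0 H p <-> winning g (inf_set p).
Proof.
move=> pl; split=> [[alive infO]|/=/andP[winp /forall_inP alive]] /=.
  by rewrite infO; apply/forall_inP=> x; rewrite inE => /asboolP/(_ 0)[n _ <-].
split=> // n; apply/negP=> dead.
have loop k : p (n + k) = p n.
  elim: k => [|k IHk]; first by rewrite addn0.
  by have := pl (n + k); rewrite addnS IHk dead.
have /alive : p n \in inf_set p; last by rewrite dead.
rewrite inE; apply/asboolP=> m; exists (n + m); last exact: loop.
exact: leq_addl.
Qed.

Lemma good_won_by sigma p : play H p -> good g sigma (inf_set p) ->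
  won_by H sigma p.
Proof.
move=> pl; case: sigma; rewrite /good ?addbT ?addbF /=.
  by move=> /negP nwin /(won0_winning pl).
by move=> win; apply/won0_winning.
Qed.

Lemma pick_succ : exists next : T -> T, forall x, succ H x != set0 ->
  next x \in succ H x.
Proof.
have /choice[next nextP] : forall x, exists y, succ H x != set0 -> y \in succ H x.
  move=> x; case: (boolP (succ H x != set0)) => [/set0Pn[y yx]|_]; first by exists y.
  by exists x.
by exists next.
Qed.

Lemma winsr_wins sigma P x : winsr g sigma P -> gtrap g (~~ sigma) P setT ->
  x \in P -> wins H sigma x.
Proof.
move=> winP [_ P1 P2] xP; have [f legf wf] := winsr_winss x winP.
have [next nextP] := pick_succ.
exists (fun h => if last x h \in P then f h else next (last x h)).
  move=> h y yV dead; rewrite last_rcons; case: ifP => [yP|_]; last exact: nextP.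
  by have [_] := legf h y yP (vert_of_owner yV); rewrite edge_succ.
move=> p p0 pl cons; have /play_edge ep := pl.
(* [consistent] demands nothing at a dead end, but there the loop is the only edge for the play and
   for [f]. *)
have pf n : p n \in P -> owner g (p n) = sigma -> p n.+1 = f (mkseq p n.+1).
  move=> pn on; have [_] := legf (mkseq p n) _ pn on; rewrite -mkseqS.
  have [dead|alive] := eqVneq (succ H (p n)) set0.
    by move=> /(edge_dead dead)->; apply: edge_dead (ep n).
  have last_p : last x (mkseq p n.+1) = p n by rewrite mkseqS last_rcons.
  by move=> _; rewrite cons // ?owner_vert_of // last_p pn.
have pP n : p n \in P.
  elim: n => [|n pn]; first by rewrite p0.
  have [on|/negb_neq on] := eqVneq (owner g (p n)) sigma; last exact: (P1 (p n)).
  by rewrite pf // mkseqS; have [] := legf (mkseq p n) _ pn on.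
by apply: good_won_by => //; apply: wf => n; [split | apply: pf].
Qed.

Lemma wins_disjoint x : wins H false x -> ~ wins H true x.
Proof.
move=> [f legf wf] [k legk wk].
have [p p0 pn] := history_play x (fun h y => if succ H y == set0 then y
  else if y \in vert0 H then f h else k h).
have pl : play H p.
  move=> n; rewrite pn; case: (boolP (succ H (p n) == set0)) => // alive.
  rewrite mkseqS; case: ifP => [p0n|/negbT p0n].
    exact: legf.
  apply: legk => //; apply: owner_vert_of => //.
  by case/set0Pn: alive => y /succP[[] [pV _]] //; rewrite pV in p0n.
have cf : consistent H false f p.
  by move=> n pV alive; rewrite pn (negbTE alive) pV.
have ck : consistent H true k p.
  move=> n pV alive; rewrite pn (negbTE alive) ifN //.
  by apply/negP=> /(@vert_of_owner false); rewrite (vert_of_owner pV).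
exact: (wk p) (wf p _ _ _).
Qed.

Lemma Win_regions P Q : winsr g false P -> gtrap g true P setT ->
  winsr g true Q -> gtrap g false Q setT -> verts H \subset P :|: Q ->
  Win H false = verts H :&: P /\ Win H true = verts H :&: Q.
Proof.
move=> winP trP winQ trQ /subsetP VPQ.
have wP x : x \in P -> wins H false x by apply: winsr_wins.
have wQ x : x \in Q -> wins H true x by apply: winsr_wins.
split; apply/setP=> x; rewrite !inE -!in_setU; case: (boolP (x \in _)) => //= xV;
  apply/asboolP/idP => [win|]; auto; move: (VPQ x xV); rewrite inE => /orP[] //.
  by move/wQ/(wins_disjoint win).
by move/wP/wins_disjoint.
Qed.

Lemma Win_splits P : splits g false setT P ->
  Win H false = verts H :&: P /\ Win H true = verts H :\: P.
Proof.
case=> trP winP trQ winQ.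
have [|->->] := Win_regions winP trP winQ trQ.
  by rewrite setTD setUCr subsetT.
by split=> //; rewrite setTD setDE.
Qed.

Lemma Win_true : Win H true = verts H :\: Win H false.
Proof.
have [P /Win_splits[-> ->]] := split_exists false live_setT.
by rewrite setDIr setDv set0U.
Qed.

Lemma attr_verts sigma X : X \subset verts H -> attr g sigma setT X \subset verts H.
Proof.
move=> XV; apply/subsetP=> x xA.
have [att [attS attP]] := attr_move sigma X live_setT.
have [//|xV] := boolP (x \in verts H).
have dead : succ H x = set0.
  apply/eqP/negPn/negP=> /set0Pn[y /succP[rho [/vert_of_verts]]].
  by rewrite (negbTE xV).
have [n||n _] := attr_reach (p := fun=> x) (N := 0) attP _ _ (leq0n 0) xA.
- by rewrite inE /= dead !eqxx.
- by move=> n _ _ _ _; have [_ /(edge_dead dead)] := attS x (in_setT x).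
by move=> /(subsetP XV); rewrite (negbTE xV).
Qed.

(** For the hard inclusion, a forcing strategy is played against moves that stay outside [attr],
    whose complement is a trap for [sigma]. *)
Lemma AttrE sigma X : X \subset verts H -> Attr sigma X H = attr g sigma setT X.
Proof.
move=> XV; have liveT := live_setT.
have [att [attS attP]] := attr_move sigma X liveT.
apply/setP=> x; apply/idP/idP; last first.
  move=> xA; rewrite inE (subsetP (attr_verts sigma XV)) //=; apply/asboolP.
  exists (fun h => att (last x h)).
    move=> h y yV alive; rewrite last_rcons -edge_succ //.
    by have [] := attS y (in_setT y).
  move=> p p0 /play_edge ep cons.
  rewrite -p0 in xA.
  have [n||n _ pn] := attr_reach (p := p) (N := 0) attP _ _ (leq0n 0) xA.
  - by rewrite inE.
  - move=> n _ _ _ on; have [dead|alive] := eqVneq (succ H (p n)) set0.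
      rewrite (edge_dead dead (ep n)).
      by have [_ /(edge_dead dead)] := attS (p n) (in_setT _).
    by rewrite cons ?owner_vert_of // mkseqS last_rcons.
  by exists n.
rewrite inE => /andP[xV /asboolP[f legf wf]]; apply/negPn/negP=> xA.
have [_ C1 C2] := gtrap_attrC sigma X liveT.
set C := setT :\: _ in C1 C2.
have /choice[avoid avoidP] : forall y, exists z, y \in C -> owner g y = ~~ sigma ->
    z \in C /\ edge g y z.
  move=> y; case: (boolP (y \in C)) => yC; last by exists y.
  have [oy|oy] := eqVneq (owner g y) (~~ sigma); last first.
    by exists y => _ /eqP; rewrite (negbTE oy).
  by have [z] := C2 y yC oy; exists z.
have [p p0 pn] := history_play x (fun h y => if succ H y == set0 then y
  else if y \in vert_of H sigma then f h else avoid y).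
have stepC n : p n \in C -> p n.+1 \in C /\ edge g (p n) (p n.+1).
  move=> pC; rewrite pn; case: ifP => [dead|/negbT alive].
    by split=> //=; rewrite dead.
  case: ifP => [pV|/negbT pV].
    have ef : edge g (p n) (f (mkseq p n.+1)).
      by rewrite edge_succ // mkseqS; apply: legf.
    by split=> //; apply: C1 pC (vert_of_owner pV) _ ef.
  apply: avoidP => //; apply: negb_neq; apply: contra pV => /eqP.
  exact: owner_vert_of.
have pC n : p n \in C.
  by elim: n => [|n /stepC[]//]; rewrite p0 !inE xA.
have [||n pX] := wf p p0.
- by apply/play_edge=> n; have [] := stepC n (pC n).
- by move=> n pV alive; rewrite pn (negbTE alive) pV.
have := pC n; rewrite inE (subsetP (sub_attr _ _ _)) //.
Qed.

End TotalGame.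

(** * The three cases of the algorithm *)

Section Steps.
Variables (T : finType) (H : game T).
Hypothesis muH : muller_game H.
Implicit Types (S P Q W X : {set T}) (x y : T) (sigma : bool).

Local Notation g := (total_game H).

Lemma subgameP W : reflect
  (W \subset verts H /\ forall x, x \in W -> exists2 y, y \in W & y \in succ H x)
  (determines_subgame H W).
Proof.
apply: (iffP andP) => -[WV]; [move/forall_inP|]; move=> succW; split=> //.
  by move=> x /succW/set0Pn[y /setIP[yx yW]]; exists y.
apply/forall_inP=> x /succW[y yW yx].
by apply/set0Pn; exists y; rewrite inE yx.
Qed.

Lemma subgame_alive W x : determines_subgame H W -> x \in W -> succ H x != set0.
Proof.
by case/subgameP=> _ succW /succW[y _ yx]; apply/set0Pn; exists y.
Qed.

Lemma subgame_winning W : determines_subgame H W -> winning g W = (W \in Omega H).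
Proof.
move=> subW /=; case: (W \in _) => //=.
by apply/forall_inP=> x; apply: subgame_alive.
Qed.

Lemma muller_restrict W (O : {set {set T}}) :
  O \subset powerset (verts H :&: W) -> muller_game (Game (restrict H W) O).
Proof.
move=> OW; case: muH => dis /subsetP edgeH _; split.
- by apply: disjointWl (subsetIl _ _) _; apply: disjointWr (subsetIl _ _) _.
- apply/subsetP=> -[x y]; rewrite !inE /= => /andP[/edgeH + /andP[-> ->]].
  by rewrite !inE /= !andbT.
- by rewrite /verts /= -setIUl.
Qed.

Lemma succ_restrict W x : x \in W -> succ (restrict H W) x = succ H x :&: W.
Proof.
by move=> xW; apply/setP=> y; rewrite in_setI !in_succ !inE /= xW.
Qed.

(** The restricted arena is traded for the full one with fewer winning sets, so that [winsr_agree]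
    can compare decompositions. *)
Lemma forced_connectedP W :
  reflect (determines_subgame H W /\ winsr (single g W) false W)
    (forced_connected H W).
Proof.
pose K := Game (restrict H W) [set W].
apply: (iffP andP) => -[subW winW]; split=> //;
  have [WV succW] := subgameP W subW.
all: have muK : muller_game K
  by apply: muller_restrict; rewrite sub1set inE subsetI WV subxx.
all: have aliveK x : x \in W -> succ K x != set0
  by move=> xW; have [y yW yx] := succW x xW; rewrite succ_restrict //;
     apply/set0Pn; exists y; rewrite inE yx.
all: have agK : agree (total_game K) (single g W) W
  by move=> x xW; split=> [|y yW] /=; [rewrite inE xW andbT |
     rewrite (negbTE (aliveK x xW)) (negbTE (subgame_alive subW xW));
     rewrite succ_restrict // inE yW andbT].
all: have winningK X : X \subset W -> winning (total_game K) X = (X == W)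
  by move=> /subsetP XW; rewrite /= inE andbC; case: forall_inP => // -[] x /XW;
     apply: aliveK.
all: have trK sigma : gtrap (total_game K) sigma W setT
  by split=> [|x y xW _ _|x xW _]; [exact: subsetT
    | rewrite /= (negbTE (aliveK x xW)) succ_restrict // => /setIP[]
    | have [y yW yx] := succW x xW; exists y => //;
      rewrite /= (negbTE (aliveK x xW)) succ_restrict // inE yx].
- have [P splP] := split_exists false (live_setT K).
  have [winE _] := Win_splits muK splP; case: splP => _ winP _ _.
  have WP : W \subset P.
    by move: winW; rewrite winE => /subset_trans; apply; apply: subsetIr.
  have trW : gtrap (total_game K) false W P.
    exact: gtrap_sub (trK false) WP (subsetT _).
  apply: winsr_agree agK _ (winsr_gtrap winP trW) => X XW _ _.
  by rewrite /good winningK.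
- apply/subsetP=> x xW; rewrite inE; apply/andP; split.
    by rewrite /verts /= -setIUl inE xW andbT; apply: (subsetP WV).
  apply/asboolP.
  apply: (winsr_wins (sigma := false) muK _ (trK true) xW).
  apply: winsr_agree (agree_sym agK) _ winW => X XW _ _.
  by rewrite /good winningK.
Qed.

Lemma Win_delete W :
  W \in Omega H -> (forall X, X \in Omega H -> X \subset W -> X != set0 -> X = W) ->
  ~~ forced_connected H W -> Win (Game H (Omega H :\ W)) false = Win H false.
Proof.
move=> WO minW nfc; set K := Game H _.
have muK : muller_game K.
  case: muH => ? ? OV; split=> //.
  exact: subset_trans (subsetDl _ _) OV.
have [P splP] := split_exists false (live_setT H).
have [-> _] := Win_splits muH splP; case: splP => trP winP trQ winQ.
have agT S : agree g (total_game K) S by [].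
have [-> //] : Win K false = verts K :&: P /\ Win K true = verts K :\: P.
apply: Win_splits => //; split=> //.
  apply: winsr_agree (agT P) _ winP => X XP X0 winX.
  rewrite /good !addbF /= => /andP[XO alive].
  rewrite !inE XO alive !andbT; apply: contraNneq nfc => XW.
  rewrite {X}XW in XO X0 alive winX XP.
  have WV : W \subset verts H by case: muH => _ _ /subsetP/(_ W WO); rewrite inE.
  have subW : determines_subgame H W.
    apply/subgameP; split=> // x xW; have [y yW] := winsr_live winX xW.
    by rewrite edge_succ ?(forall_inP alive) //; exists y.
  apply/forced_connectedP; split=> //.
  (* By minimality [W] is the only nonempty winning set inside [W], so its decomposition is also one
     in [single g W]. *)
  apply: winsr_agree winX => // X XW X0' _.
  by rewrite /good !addbF /= => /andP[XO' _]; apply/eqP; apply: minW.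
apply: winsr_agree (agT _) _ winQ => X _ _ _.
rewrite /good !addbT /=; apply: contra => /andP[/setD1P[_ ->]].
by [].
Qed.

(** The complement of [A] is a trap for player 0, so restricting to it creates no dead ends and the
    games agree there. Player 0 wins [A] joined with the part [P] of the rest by the dominion rule
    for [W]. *)
Lemma Win_attr W (A := Attr false W H) :
  W \in Omega H -> forced_connected H W -> trap true H W ->
  let K := Game (restrict H (~: A)) ([set X in Omega H | [disjoint X & A]] :\ W) in
  muller_game K /\ Win H false = A :|: Win K false.
Proof.
move=> WO /forced_connectedP[subW winW] /andP[_ /subsetP trapW] K.
have [WV succW] := subgameP W subW.
have AE : A = attr g false setT W by apply: AttrE.
clearbody A.
have AV : A \subset verts H by rewrite AE; apply: attr_verts.
have WA : W \subset A by rewrite AE; apply/sub_attr/subsetT.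
have muK : muller_game K.
  apply: muller_restrict; apply/subsetP=> X; rewrite !inE => /and3P[_ XO XA].
  case: muH => _ _ /subsetP/(_ X XO); rewrite inE subsetI => ->.
  by rewrite -disjoints_subset.
have trC : gtrap g false (~: A) setT.
  by rewrite -setTD AE; apply/gtrap_attrC/live_setT.
have liveC := live_gtrap (live_setT H) trC.
have agC : agree g (total_game K) (~: A).
  have [_ C1 C2] := trC; move=> x xC; split=> [|y yC] /=.
    by rewrite inE xC andbT.
  rewrite succ_restrict // in_setI yC andbT.
  have [->|alive] := eqVneq (succ H x) set0; first by rewrite set0I eqxx.
  rewrite ifN //; apply/set0Pn.
  by have [z zC] := liveC x xC; rewrite edge_succ // => zx; exists z; rewrite inE zx.
have winningK X : X \subset ~: A -> X != set0 ->
    winning (total_game K) X = winning g X.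
  move=> XA X0; have dis : [disjoint X & A] by rewrite disjoints_subset.
  rewrite /= !inE dis andbT; have -> : X != W.
    apply: contraNneq X0 => XW; rewrite -subset0 -(setICr A) subsetI XA andbT.
    by rewrite XW.
  rewrite /=; congr (_ && _); apply: eq_forallb_in => x xX.
  have xC := subsetP XA x xX; rewrite succ_restrict //.
  apply/idP/idP; first by apply: contraNneq => ->; rewrite set0I.
  move=> alive; apply/set0Pn; have [z zC] := liveC x xC.
  by rewrite edge_succ // => zx; exists z; rewrite inE zx.
have [P [trP winP trQ winQ]] := split_exists false liveC.
rewrite /= in trP winQ; set Q := ~: A :\: P in trQ winQ.
have [PC P1 P2] := trP; have [QC _ _] := trQ.
have eqE S : S \subset ~: A -> verts H :&: S = verts K :&: S.
  move=> SA; have -> : verts K = verts H :&: ~: A by rewrite /verts /= -setIUl.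
  by rewrite -setIA (setIidPr SA).
have closedK sigma S : S \subset ~: A -> gtrap g sigma S (~: A) ->
    gtrap (total_game K) sigma S setT.
  move=> SC trS; have [_ S1 S2] := gtrap_agree agC trS.
  split=> [|x y xS ox _ exy|]; [exact: subsetT | | exact: S2].
  apply: (S1 x y xS ox) => //; have xC := subsetP SC x xS; move: exy => /=.
  by rewrite succ_restrict //; case: ifP => _ => [/eqP->|/setIP[]].
have [-> _] : Win K false = verts K :&: P /\ Win K true = verts K :&: Q.
  apply: Win_regions => //; try exact: closedK.
  - apply: winsr_agree (agree_sub PC agC) _ winP => X XP X0 _.
    by rewrite /good winningK //; apply: subset_trans PC.
  - apply: winsr_agree (agree_sub QC agC) _ winQ => X XQ X0 _.
    by rewrite /good winningK //; apply: subset_trans QC.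
  - rewrite -(setIidPr PC) /Q setID.
    by rewrite /verts /= -setIUl subsetIr.
have winWg : winsr g false W.
  apply: winsr_agree winW => // X _ _ _; rewrite /good !addbF => /eqP->.
  by rewrite subgame_winning.
have trA : gtrap g true (A :|: P) setT.
  have [_ C1 C2] := trC; split=> [|x y|x].
  - exact: subsetT.
  - move=> /setUP[xA|xP] ox _ exy; last first.
      by rewrite inE -implyNb; apply/implyP=> yA; apply: (P1 x); rewrite ?inE.
    rewrite inE; move: xA; rewrite {1}AE attrE in_setT andTb => /orP[xW|].
      rewrite (subsetP WA) //.
      apply: trapW; rewrite inE; apply/'exists_andP; exists x.
      split; first by rewrite inE xW.
      by move: exy; rewrite edge_succ ?(subgame_alive subW) // in_succ.
    by rewrite ox -[true == false]/false => /forall_inP/(_ y (in_setT y));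
        rewrite exy implyTb -AE => ->.
  - move=> /setUP[xA|xP] ox; last first.
      by have [y yP exy] := P2 x xP ox; exists y; rewrite // inE yP orbT.
    move: (xA); rewrite {1}AE attrE in_setT andTb => /orP[xW|].
      have [y yW yx] := succW x xW; exists y.
        by rewrite inE (subsetP WA).
      by rewrite edge_succ // (subgame_alive subW).
    rewrite ox -[~~ true == false]/true -AE => /'exists_andP[y [yA exy]]; exists y => //.
    by rewrite inE yA.
have CE : setT :\: (A :|: P) = Q by rewrite setTD setCU /Q setDE.
have [-> _] : Win H false = verts H :&: (A :|: P) /\
              Win H true = verts H :\: (A :|: P).
  apply: Win_splits => //; split; rewrite ?CE //; last first.
    by apply: gtrap_trans trQ trC.
  apply: (@WinsDominion _ _ _ _ W A) => //.
  - exact: live_gtrap (live_setT H) trA.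
  - have trW : gtrap g true W setT.
      split=> [|x y xW ox _|x xW _]; first exact: subsetT.
        rewrite edge_succ ?(subgame_alive subW) // in_succ => exy.
        apply: trapW; rewrite inE; apply/'exists_andP; exists x.
        by rewrite inE xW.
      have [y yW yx] := succW x xW; exists y => //.
      by rewrite edge_succ // (subgame_alive subW).
    by apply: gtrap_sub trW _ (subsetT _); apply: subset_trans WA (subsetUl _ _).
  - rewrite {1}AE; apply: attr_restrict; last exact: subsetT.
    by rewrite -AE subsetUl.
  - suff -> : (A :|: P) :\: A = P by [].
    by rewrite setDUl setDv set0U; apply/setDidPl; rewrite disjoints_subset.
by split=> //; rewrite setIUr (setIidPr AV) eqE.
Qed.

Lemma Win_horn W w :
  W \in Omega H -> w \notin verts H -> forced_connected H W -> ~~ trap true H W ->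
  muller_game (horn H W w) /\
  forall x, x != w -> (x \in Win (horn H W w) false) = (x \in Win H false).
Proof.
move=> WO wV /forced_connectedP[subW winW] ntrap; set K := horn H W w.
have [WV succW] := subgameP W subW.
have [dis edgeH OV] := muH.
have wX X : X \in Omega H -> w \notin X.
  move=> /(subsetP OV); rewrite inE => /subsetP XV.
  by apply: contra wV; apply: XV.
have wW := wX W WO.
have wno x : x \in verts H -> x != w by apply: contraTneq => ->.
have edgew x y : (x, y) \in edges H -> x != w /\ y != w.
  rewrite -(@in_succ _ H) => /(succP muH)[sigma [/vert_of_verts xV /vert_of_verts yV]].
  by rewrite !wno.
have muK : muller_game K.
  split.
  - rewrite disjoint_subset; apply/subsetP=> x x0; rewrite !inE negb_or.
    rewrite (disjointFr dis x0) andbT.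
    by apply: contraNneq wV => <-; rewrite inE x0.
  - apply/subsetP=> -[x y]; rewrite !inE /=.
    case/orP=> [/orP[/(subsetP edgeH)|/andP[/andP[-> _] ->]]|].
    + by rewrite !inE /= => /orP[]/andP[-> ->]; rewrite !orbT.
    + by [].
    + case/andP=> /eqP-> /andP[_ /'exists_andP[u [/setIP[u1 _]]]].
      rewrite -(@in_succ _ H) => /(succP muH)[sigma [uV yV]].
      have := vert_of_owner muH uV; rewrite /= u1 => E.
      by rewrite -E /= in yV; rewrite eqxx yV !orbT.
  - apply/subsetP=> X; rewrite !inE => /andP[_ XO].
    have sub Y : Y \in Omega H -> Y \subset verts K.
      move=> /(subsetP OV); rewrite inE => /subset_trans; apply.
      by rewrite /verts /= setUCA subsetUr.
    case/orP: XO => [/sub //|/imsetP[Y YR ->]].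
    rewrite subUset sub1set !inE eqxx orbT /=; apply: sub.
    by move: YR; rewrite inE => /andP[].
split=> // x xw.
have succK y z : y != w -> z != w -> (z \in succ K y) = (z \in succ H y).
  move=> yw zw; rewrite !in_succ !inE /= (negbTE yw) (negbTE zw).
  by rewrite andbF !orbF.
have succKw y : y != w -> (w \in succ K y) = (y \in vert0 H :&: W).
  move=> yw; rewrite in_succ !inE /= eqxx (negbTE yw) andbT orbF.
  by case: (boolP ((y, w) \in edges H)) => // /edgew[_]; rewrite eqxx.
have exitsE : succs H (vert1 H :&: W) :\: W = exits g W.
  apply/setP=> y; rewrite !inE; congr (_ && _); apply: eq_existsb => u.
  rewrite !inE andbAC; case: (boolP (u \in W)) => uW; rewrite ?andbF //= andbT andbC.
  by rewrite (negbTE (subgame_alive subW uW)) in_succ andbC.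
have succw y : (y \in succ K w) = (y \in exits g W).
  rewrite -exitsE in_succ 2!in_setU !in_setX set11 in_setI (negbTE wW) andbF orbF.
  by case: (boolP ((w, y) \in edges H)) => // /edgew[]; rewrite eqxx.
have exits0 : exits g W != set0.
  apply: contra ntrap => /eqP ex0; rewrite /trap subW -setD_eq0 /= setIC.
  by rewrite exitsE ex0.
(* New edges to [w] start in [W], where every vertex already has a successor. *)
have deadK y : y != w -> (succ K y == set0) = (succ H y == set0).
  move=> yw; apply/eqP/eqP=> dead; apply/setP=> z; rewrite in_set0.
    have [->|zw] := eqVneq z w; last by rewrite -succK // dead inE.
    by rewrite in_succ; apply/negbTE/negP => /edgew[]; rewrite eqxx.
  have [->|zw] := eqVneq z w; last by rewrite succK // dead inE.
  rewrite succKw // inE; apply/negbTE/negP => /andP[_ yW].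
  by have := subgame_alive subW yW; rewrite dead eqxx.
have deadw : succ K w != set0.
  by case/set0Pn: exits0 => y yex; apply/set0Pn; exists y; rewrite succw.
have aliveK X : w \notin X ->
    [forall y in X, succ K y != set0] = [forall y in X, succ H y != set0].
  move=> wX'; apply: eq_forallb_in => y yX.
  by rewrite deadK //; apply: contraNneq wX' => <-.
have liveV : live g (~: [set w]).
  move=> y; rewrite !inE => yw /=.
  have [_|/set0Pn[z zy]] := eqVneq (succ H y) set0.
    by exists y; rewrite ?inE.
  exists z => //; rewrite !inE; rewrite in_succ in zy.
  by case: (edgew _ _ zy).
have [P splP] := split_exists false liveV.
have OK1 X : w \notin X -> (X \in Omega K) = (X \in Omega H) && ~~ (W \subset X).
  move=> wX'; rewrite in_setD !in_setU in_set1 inE properEneq.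
  have -> : (X \in [set w |: Y | Y in strict_supersets H W]) = false.
    by apply/negbTE; apply: contra wX' => /imsetP[Y _ ->]; rewrite setU11.
  rewrite orbF; case: (X \in Omega H); rewrite ?andbF // !andbT negb_or.
  by have [->|] := eqVneq X W; rewrite ?subxx // eq_sym => /negbTE->.
have OK2 X : w \notin X ->
    (w |: X \in Omega K) = (X \in Omega H) && (W \proper X).
  move=> wX'; have wNO : (w |: X \in Omega H) = false.
    by apply/negbTE/negP=> /wX; rewrite setU11.
  rewrite in_setD !in_setU in_set1 [_ \in strict_supersets _ _]inE wNO /=.
  have -> : (w |: X == W) = false.
    by apply: contraNF wW => /eqP<-; rewrite setU11.
  apply/imsetP/idP => [[Y]|XR]; last by exists X; rewrite ?inE.
  rewrite inE => /andP[YO WY] /(congr1 (fun Z => Z :\ w)).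
  by rewrite setU1K // setU1K ?(wX _ YO) // => ->; rewrite YO.
have [P' splP' P'E] :
    exists2 P', splits (total_game K) false setT P' & P' :\ w = P.
  apply: (@horn_splits _ g (total_game K) W w) splP => //.
  - by move=> y yw /=; rewrite !inE (negbTE yw).
  - exact: setU11.
  - by move=> y z yw zw; rewrite /= deadK // succK.
  - move=> y yw /=; rewrite deadK //.
    have [dead|alive] := eqVneq (succ H y) set0.
      rewrite eq_sym (negbTE yw); symmetry; apply/negbTE/negP => /andP[yW _].
      by have := subgame_alive subW yW; rewrite dead eqxx.
    rewrite succKw // inE andbC; congr (_ && _).
    apply/idP/idP => [y0|y1]; first by rewrite (disjointFr dis y0).
    apply: (owner_vert_of muH alive (sigma := false)); exact/negbTE.
  - by move=> y; rewrite /= (negbTE deadw) succw.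
  - move=> y yw /=; case: ifP => _; first by rewrite eq_sym (negbTE yw).
    by rewrite in_succ; apply/negbTE/negP=> /edgew[_]; rewrite eqxx.
  - by move=> X wX'; rewrite /= OK1 // aliveK // andbAC.
  - move=> X wX'; rewrite /= OK2 // andbAC; congr (_ && _ && _).
    rewrite -aliveK //; apply/forall_inP/forall_inP=> al y yX.
      by apply: al; rewrite setU1r.
    by case/setU1P: yX => [->//|/al].
  - by rewrite subgame_winning.
  (* The source of an exit belongs to player 1, so its successor inside [W] belongs to player 0. *)
  - case/set0Pn: exits0 => y.
    rewrite inE => /andP[_ /'exists_andP[u [uW /andP[u1 _]]]].
    have [z zW zu] := succW u uW; exists z => //.
    have [sigma [uV zV]] := succP muH zu.
    have := vert_of_owner muH uV; rewrite u1 => E.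
    by rewrite (vert_of_owner muH zV) -E.
have [-> _] := Win_splits muK splP'.
have [trP winP trQ winQ] := splP; have [PV _ _] := trP.
have closedV sigma S : gtrap g sigma S (~: [set w]) -> gtrap g sigma S setT.
  move=> [SV S1 S2]; split=> // y z yS oy _ yz.
  apply: (S1 y) => //; rewrite !inE; have := subsetP SV y yS; rewrite !inE => yw.
  move: yz => /=; case: ifP => _ => [/eqP-> //|].
  by rewrite in_succ => /edgew[].
have [|-> _] := Win_regions muH winP (closedV _ _ trP) winQ (closedV _ _ trQ).
  by apply/subsetP=> y /wno yw; rewrite !inE yw andbT orbN.
rewrite -P'E !in_setI in_setD1 xw; congr (_ && _).
by rewrite !inE (negbTE xw).
Qed.

End Steps.

(** * The invariant of the algorithm *)

Lemma Win_Omega0 (T : finType) (H : game T) :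
  muller_game H -> Omega H = set0 -> Win H false = set0.
Proof.
move=> muH O0; have [P splP] := split_exists false (live_setT H).
have [-> _] := Win_splits muH splP; case: splP => _ winP _ _.
suff -> : P = set0 by rewrite setI0.
apply/eqP/negPn/negP => /(winsr_dominion winP)[D [_ _ _]].
by rewrite /good addbF /= O0 inE.
Qed.

(** * The input game inside the tagged vertex type *)

Section Embedding.
Variables (T : finType) (H : game T).
Hypothesis muH : muller_game H.
Implicit Types (v : T) (x : vertex T) (sigma : bool).

Let inl_inj : injective (@inl T {set T}).
Proof. by move=> ? ? []. Qed.

Lemma mem_embed_set v (X : {set T}) : (inl v \in embed_set X) = (v \in X).
Proof. exact: mem_imset. Qed.

Lemma vert_of_embed sigma :
  vert_of (embed H) sigma = embed_set (vert_of H sigma).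
Proof. by case: sigma. Qed.

Lemma verts_embed : verts (embed H) = embed_set (verts H).
Proof. by rewrite /embed_set imsetU. Qed.

Lemma succ_embed v : succ (embed H) (inl v) = embed_set (succ H v).
Proof.
apply/setP=> y; rewrite in_succ; apply/imsetP/imsetP => -[].
  by move=> [u z] uz [-> ->]; exists z => //; rewrite in_succ.
by move=> z; rewrite in_succ => vz ->; exists (v, z).
Qed.

Lemma embed_set_eq0 (X : {set T}) : (embed_set X == set0) = (X == set0).
Proof. by rewrite imset_eq0. Qed.

Lemma muller_embed : muller_game (embed H).
Proof.
case: muH => dis /subsetP edgeH /subsetP OV; split.
- rewrite disjoint_subset; apply/subsetP=> _ /imsetP[v v0 ->].
  by rewrite !inE mem_embed_set (disjointFr dis v0).
- apply/subsetP=> _ /imsetP[[u z] /edgeH uz ->].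
  by move: uz; rewrite !inE /= !mem_embed_set.
- apply/subsetP=> _ /imsetP[X /OV + ->]; rewrite !inE => XV.
  by rewrite verts_embed imsetS.
Qed.

Lemma wins_embed sigma v : wins H sigma v -> wins (embed H) sigma (inl v).
Proof.
pose proj x : option T := if x is inl u then Some u else None.
have projK : pcancel inl proj by [].
case=> f legf wf; exists (fun h => inl (f (pmap proj h))).
  move=> h x; rewrite vert_of_embed => /imsetP[u uV ->].
  rewrite succ_embed embed_set_eq0 => alive.
  by rewrite -cats1 pmap_cat /= cats1 mem_embed_set; apply: legf.
move=> p p0 pl cons; pose q n := odflt v (proj (p n)).
have pq n : p n = inl (q n).
  elim: n => [|n IHn]; first by rewrite /q p0.
  have := pl n; rewrite {1 3}IHn succ_embed embed_set_eq0 /q.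
  by case: ifP => _ => [->|/imsetP[u _ ->]//]; rewrite IHn.
have histq n : pmap proj (mkseq p n) = mkseq q n.
  by rewrite -(map_pK projK (mkseq q n)) -map_comp; congr pmap; apply: eq_map.
have plq : play H q.
  move=> n; have := pl n; rewrite !pq succ_embed embed_set_eq0 mem_embed_set.
  by case: ifP => // _ /inl_inj.
have consq : consistent H sigma f q.
  move=> n qV alive; have := cons n.
  rewrite !pq vert_of_embed succ_embed embed_set_eq0 mem_embed_set histq.
  by move=> /(_ qV alive)/inl_inj.
have infq : inf_set p = embed_set (inf_set q).
  apply/setP=> x; apply/idP/imsetP => [|[u]].
    rewrite inE => /asboolP inf; have [n _ pn] := inf 0.
    exists (q n); last by rewrite -pn pq.
    rewrite inE; apply/asboolP=> m; have [k mk pk] := inf m; exists k => //.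
    by apply: inl_inj; rewrite -!pq pk.
  rewrite inE => /asboolP inf ->; rewrite inE; apply/asboolP=> m.
  by have [k mk qk] := inf m; exists k => //; rewrite pq qk.
have won : won0 (embed H) p <-> won0 H q.
  rewrite /won0 infq /= mem_imset; last exact: imset_inj.
  by split=> -[alive ?]; split=> // n; move: (alive n);
    rewrite pq succ_embed embed_set_eq0.
have := wf q _ plq consq; rewrite /q p0 /= => /(_ erefl).
by case: sigma {legf wf cons consq} => /=; [move=> nwin /won | move/won].
Qed.

(** Strategies are transported in one direction only; the converse uses determinacy of [H] and
    transports a win of player 1. *)
Lemma Win_embed v : (inl v \in Win (embed H) false) = (v \in Win H false).
Proof.
rewrite [LHS]inE [RHS]inE verts_embed mem_embed_set.
case: (boolP (v \in verts H)) => //= vV; apply/asboolP/asboolP => win; last first.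
  exact: wins_embed.
apply: contrapT => nwin.
have : v \in Win H true.
  by rewrite Win_true // in_setD vV andbT inE vV /=; apply/asboolPn.
rewrite inE => /andP[_ /asboolP /wins_embed].
exact: (wins_disjoint muller_embed win).
Qed.

End Embedding.

Section Invariant.
Variables (T : finType) (H : game T) (s : seq {set T}).
Hypothesis muH : muller_game H.
Hypothesis hs : inclusion_listing (Omega H) s.
Implicit Types (X Y W : {set vertex T}) (st : state T).

(** Added vertices do not change it, so it identifies the listed set from which [X] stems. *)
Definition base X : {set T} := inl @^-1: X.

(** [inv_fresh] speaks of the remaining sets, as a treated set may have used its name; [inv_base]
    keeps their places in the list. *)
Record invariant st : Prop := Invariant {
  inv_muller : muller_game (cur st);
  inv_order : {subset Omega (cur st) <= Defs.order st};
  inv_base : map base (Defs.order st) = s;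
  inv_fresh : forall X, X \in Omega (cur st) -> new_vertex X \notin verts (cur st);
  inv_Win : forall v, (inl v \in Win (embed H) false) =
     (inl v \in win0 st) || (inl v \in Win (cur st) false) }.

Lemma head_filter (U : eqType) (a : pred U) (l : seq U) x y r :
  [seq z <- l | a z] = y :: r -> x \in l -> a x -> index y l <= index x l.
Proof.
elim: l => //= z l IHl; case: ifP => [_ [-> _]|nz /IHl{}IHl]; first by rewrite eqxx.
have [<- _|_] := eqVneq z x; first by rewrite nz.
by rewrite inE => /orP[/eqP->|xl ax]; rewrite ?nz //; case: ifP => // _; apply: IHl.
Qed.

Lemma index_base st X : invariant st -> X \in Defs.order st ->
  index (base X) s = index X (Defs.order st).
Proof.
case=> _ _ baseE _ _ Xo; case: hs => us _ _.
rewrite -{1}(nth_index set0 Xo) -(nth_map _ set0) ?index_mem // baseE.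
by rewrite index_uniq // -baseE size_map index_mem.
Qed.

Lemma base_inj st : invariant st -> {in Defs.order st &, injective base}.
Proof.
move=> inv X Y Xo Yo eqXY; rewrite -(nth_index set0 Xo) -(nth_index set0 Yo).
by rewrite -!index_base // eqXY.
Qed.

Lemma invariant_init : invariant (init H s).
Proof.
case: hs => _ sO _; split=> /=.
- exact: muller_embed.
- by move=> _ /imsetP[X XO ->]; rewrite map_f // sO.
- rewrite -map_comp; apply: map_id_in => X _ /=.
  by apply/setP=> v; rewrite inE mem_embed_set.
- by move=> X _; rewrite verts_embed; apply/negP => /imsetP[].
- by move=> v; rewrite in_set0.
Qed.

Lemma invariant_step st : invariant st -> invariant (step st).
Proof.
move=> inv; have [mu sub baseE fresh winE] := inv.
have [sub' _] := step_order sub; move: sub'; rewrite /step.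
case E: [seq X <- Defs.order st | X \in Omega (cur st)] => [|W l]; first by [].
have: W \in [seq X <- Defs.order st | X \in Omega (cur st)] by rewrite E mem_head.
rewrite mem_filter => /andP[WO Wo].
(* Bases are injective on the list, so a smaller set would have a strictly smaller base, an earlier
   place in [s], and would have been taken first. *)
have minW X : X \in Omega (cur st) -> X \subset W -> X = W.
  move=> XO XW; apply: (base_inj inv (sub X XO) Wo).
  apply/eqP/negPn/negP=> neqXW; have ltXW : base X \proper base W.
    by rewrite properEneq neqXW preimsetS.
  have ins Y : Y \in Defs.order st -> base Y \in s by move=> Yo; rewrite -baseE map_f.
  case: hs => _ _ /(_ _ _ (ins X (sub X XO)) (ins W Wo) ltXW).
  rewrite !(index_base inv) ?sub // ltnNge.
  by rewrite (head_filter E (sub X XO) XO).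
rewrite /treat; case: ifP => [nfc|/negbT/negPn fc] /=.
  move=> sub'; split=> //=.
  - case: mu => ? ? OV; split=> //.
    exact: subset_trans (subsetDl _ _) OV.
  - by move=> X /setD1P[_]; apply: fresh.
  - by move=> v; rewrite Win_delete // => X XO XW _; apply: minW.
case: ifP => [trW|/negbT ntrW] /= sub'.
  have [muK WinK] := Win_attr mu WO fc trW; split=> //=.
  - move=> X /setD1P[_]; rewrite inE => /andP[XO _].
    by apply: contra (fresh X XO); rewrite !inE => /orP[]/andP[-> _]; rewrite ?orbT.
  - by move=> v; rewrite winE WinK !in_setU orbA.
have [muK WinK] := Win_horn mu WO (fresh W WO) fc ntrW.
have baseU Y : base (new_vertex W |: Y) = base Y.
  by apply/setP=> v; rewrite !inE.
split=> //=.
- rewrite -map_comp -[RHS]baseE; apply: eq_map => X /=.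
  by case: ifP => _; rewrite ?baseU.
- have freshK X : X \in Omega (cur st) -> X != W ->
      new_vertex X \notin new_vertex W |: verts (cur st).
    move=> XO XW; rewrite in_setU1 negb_or fresh // andbT.
    apply: contra XW => /eqP[eqXW]; apply/eqP.
    exact: (base_inj inv (sub X XO) Wo eqXW).
  have vertsK : verts (horn (cur st) W (new_vertex W)) =
      new_vertex W |: verts (cur st) by rewrite /verts /= setUCA.
  move=> X; rewrite vertsK => /setDP[/setUP[XO|/imsetP[Y YR ->]] XWR].
    by apply: freshK => //; apply: contra XWR => /eqP->; rewrite setU11.
  rewrite (_ : new_vertex (_ |: _) = new_vertex Y); last by congr inr; apply: baseU.
  move: YR; rewrite inE => /andP[YO WY]; apply: freshK => //.
  by apply: contraTneq WY => ->; rewrite properxx.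
- by move=> v; rewrite WinK.
Qed.

End Invariant.

Theorem theorem8 (T : finType) (G : game T) (s : seq {set T})
    (hG : muller_game G) (hs : inclusion_listing (Omega G) s) :
  let Win0 := algorithm_Win0 G s in
  Win G false = [set v in verts G | inl v \in Win0] /\
  Win G true = [set v in verts G | inl v \notin Win0].
Proof.
move=> Win0; have inv : invariant G s (run G s).
  rewrite /run; elim: #|Omega G| => [|n IHn]; first exact: invariant_init.
  by rewrite iterS; apply: invariant_step.
have WinE v : (v \in Win G false) = (inl v \in Win0).
  rewrite -Win_embed // (inv_Win inv) (Win_Omega0 (inv_muller inv)) ?inE ?orbF //.
  exact: run_exit.
split; apply/setP=> v.
  rewrite [RHS]inE -WinE andb_idl // inE.
  by case/andP.
by rewrite Win_true // in_setD [RHS]inE WinE andbC.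
Qed.
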